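(* Let $(X,\bullet)$ be a pointed, path-connected diffeological space, and let $\Theta$ be the universal connection on the pointed path bundle $\tau:\mathcal F_\bullet(X)\to X$. Given a smooth path $\alpha:(a,b)\to X$, an initial time $t_0\in(a,b)$, and an initial path $[\beta_0]\in\tau^{-1}(\alpha(t_0))$, define $\bar\alpha_{\beta_0}:(a,b)\to\mathcal F_\bullet(X)$ by $$\bar\alpha_{\beta_0}(s)=[\alpha^{t_0\to s}\vee\beta_0].$$ Then $\mathrm{hor}_\Theta(\alpha,t_0,[\beta_0])=\bar\alpha_{\beta_0}$.
   Context: Diffeology. Diffeological spaces, plots, smooth maps, and the subspace, product, quotient and functional diffeologies are the standard ones; $[0,1]\subseteq\mathbb R$ has the subspace diffeology. A diffeological group is a group with a diffeology making multiplication and inversion smooth. For a diffeological space $(Y,\mathcal D)$, $\mathcal D$ carries the functional diffeology: $r\mapsto\psi_r$ ($r\in U$) is a plot iff for all $r_0\in U$, $s_0\in\mathrm{dom}(\psi_{r_0})$ there are open neighborhoods $V\subseteq U$ of $r_0$ and $W\subseteq\mathrm{dom}(\psi_{r_0})$ of $s_0$ with $W\subseteq\mathrm{dom}(\psi_r)$ for all $r\in V$ and $(r,s)\mapsto\psi_r(s)$ a plot on $V\times W$. $\mathcal PY\subseteq\mathcal D$ is the subspace of plots defined on open intervals of $\mathbb R$ (smooth paths), and $\hat{\mathcal P}Y=\{(\alpha,t)\in\mathcal PY\times\mathbb R: t\in\mathrm{dom}(\alpha)\}$ with the subspace diffeology. $X$ is path-connected if any two points lie in the image of some $\alpha\in\mathcal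 PX$. Bundles and connections. For a diffeological group $G$, a diffeological principal $G$-bundle is a smooth surjection $\pi:E\to X$ with a smooth right $G$-action on $E$ such that $E\times G\to E\times E$, $(p,g)\mapsto(p,pg)$, is a diffeomorphism onto its image, and there is a diffeomorphism $X\to E/G$ sending $\pi(\xi)$ to $\xi\cdot G$ for all $\xi\in E$. A diffeological connection on it is a smooth map $A:\hat{\mathcal P}E\to\mathcal PE$, $(\tilde\alpha,t)\mapsto A_t\tilde\alpha$, with: (i) $\mathrm{dom}(A_t\tilde\alpha)=\mathrm{dom}(\tilde\alpha)$; (ii) $\pi\circ A_t\tilde\alpha=\pi\circ\tilde\alpha$; (iii) $A_t\tilde\alpha(t)=\tilde\alpha(t)$; (iv) $A_t(\tilde\alpha\cdot\rho)=A_t\tilde\alpha\cdot\rho(t)$ for every smooth path $\rho:\mathrm{dom}(\tilde\alpha)\to G$; (v) $A_t(\tilde\alpha\circ f)=A_{f(t)}\tilde\alpha\circ f$ for $f\in\mathcal P(\mathrm{dom}(\tilde\alpha))$; (vi) $A_t(A_t\tilde\alpha)=A_t\tilde\alpha$. A path $\tilde\alpha\in\mathcal PE$ is $A$-horizontal if $A_t\tilde\alpha=\tilde\alpha$ for some $t$. For $\alpha\in\mathcal PX$, $t\in\mathrm{dom}(\alpha)$, $\xi\in\pi^{-1}(\alpha(t))$ the horizontal lift $\mathrm{hor}_A(\alpha,t,\xi)\in\mathcal PE$ is the $A$-horizontal path $A_t\tilde\alpha$, for any $\tilde\alpha\in\mathcal PE$ with $\pi\circ\tilde\alpha=\alpha$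 and $\tilde\alpha(t)=\xi$ (independent of the choice); it lies over $\alpha$ and takes the value $\xi$ at $t$. Path spaces. $C^\infty([0,1],X)$ has the functional diffeology. Let $C^\infty_\sim([0,1],X)=C^\infty([0,1],X)/\!\sim$, where $\alpha\sim\beta$ iff there is $f\in\mathrm{Diff}([0,1])$ with $f(0)=0$, $f(1)=1$ and $\alpha=\beta\circ f$; the class of $\alpha$ is $\ulcorner\alpha\urcorner$. For $\alpha,\beta$ with $\beta(0)=\alpha(1)$, the concatenation is $(\beta\vee\alpha)(t)=\alpha(2t)$ for $t<1/2$ and $\beta(2t-1)$ for $t\ge1/2$, and $\ulcorner\beta\urcorner\vee\ulcorner\alpha\urcorner=\ulcorner\beta\vee\alpha\urcorner$, with representatives chosen constant near $0$ and $1$. Retrace equivalence is the equivalence relation on $C^\infty_\sim([0,1],X)$ generated by the operations $\ulcorner\beta\urcorner\vee\ulcorner\alpha\urcorner\mapsto\ulcorner\beta\urcorner\vee\ulcorner\eta\urcorner\vee\ulcorner\eta^{\leftarrow}\urcorner\vee\ulcorner\alpha\urcorner$ for $\ulcorner\eta\urcorner\in C^\infty_\sim([0,1],X)$, where $\eta^{\leftarrow}(t)=\eta(1-t)$. $\mathcal F(X)$ is the quotient of $C^\infty_\sim([0,1],X)$ by retrace equivalence, with the quotient diffeology; the class of $\alpha\in C^\infty([0,1],X)$ is $[\alpha]$. By convention, the representative $\alpha$ of a given $[\alpha]\in\mathcal F(X)$ is assumed constant near $0$ and $1$, and $[\beta]\vee[\alpha]=[\beta\vee\alpha]$ for classes with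 $\beta(0)=\alpha(1)$. $\mathcal F_\bullet(X)=\{[\alpha]:\alpha(0)=\bullet\}$ and $\Omega_\bullet(X)=\{[\gamma]:\gamma(0)=\bullet=\gamma(1)\}$ have the subspace diffeology; $\Omega_\bullet(X)$ is a diffeological group under $\vee$ with $[\gamma]^{-1}=[\gamma^{\leftarrow}]$, acting on $\mathcal F_\bullet(X)$ on the right by $[\alpha]\vee[\gamma]$, and $\tau:\mathcal F_\bullet(X)\to X$, $\tau([\alpha])=\alpha(1)$, is a diffeological principal $\Omega_\bullet(X)$-bundle (the pointed path bundle). For a path $c$ on an open interval and $r,s$ in it, $c^{r\to s}:[0,1]\to X$ is $c^{r\to s}(t)=c(ts+(1-t)r)$. The universal connection is $\Theta:\hat{\mathcal P}\mathcal F_\bullet(X)\to\mathcal P\mathcal F_\bullet(X)$, $\Theta_r[\tilde\alpha](s)=[(\tau\circ[\tilde\alpha])^{r\to s}\vee\tilde\alpha(r)]$, where $[\tilde\alpha]$ denotes the smooth path $s\mapsto[\tilde\alpha(s)]$; it is a diffeological connection on $\tau$.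
   Formalization: As α^{t0→s} need not be constant near 0 and 1, its concatenation with β0 is undefined; in both Θ and ᾱ it is first precomposed with one arbitrary smooth φ:[0,1]→[0,1], 0 near 0 and 1 near 1; F_•(X) consists of classes having a representative constant near 0 and 1. *)

(* Defs.v *)
From HB Require Import structures.
From mathcomp Require Import all_boot all_order all_algebra.
From mathcomp Require Import boolp classical_sets functions reals.
From mathcomp Require Import topology normedtype landau derive.
From mathcomp Require Import lra.
From Stdlib Require Import Relation_Operators.

Import Order.TTheory GRing.Theory Num.Theory numFieldNormedType.Exports.

Set Implicit Arguments.
Unset Strict Implicit.
Unset Printing Implicit Defensive.

Local Open Scope ring_scope.
Local Open Scope classical_set_scope.

Section Smooth.
Context {R : realType}.

(* k times Frechet differentiable on U, expressed through the successive
   directional derivatives; U is open in all uses. *)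
Fixpoint kdiff (V W : normedModType R) (k : nat) (U : set V) (f : V -> W) :=
  if k is k'.+1 then
    (forall x, U x -> differentiable f x) /\
    (forall v, kdiff k' U (fun x => 'd f x v))
  else True.

Definition smooth_on (V W : normedModType R) (U : set V) (f : V -> W) :=
  forall k, kdiff k U f.

Lemma near_eq_diff (V W : normedModType R) (f g : V -> W) x :
  (\near x, f x = g x) -> differentiable f x ->
  differentiable g x /\ 'd g x = 'd f x :> (V -> W).
Proof.
move=> fg df.
have fgx : f x = g x by apply: nbhs_singleton fg.
have [cd /eqaddoP H] := (diff_locallyP x f).1 df.
have G : g \o shift x = cst (g x) + 'd f x +o_ 0 id.
  apply/eqaddoP => e e0; have := H e e0.
  have : \forall y \near (0 : V), f (y + x) = g (y + x).
    have : shift x @ (0 : V) --> x.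
      by rewrite -[X in _ --> X]add0r; apply: cvgD; [exact: cvg_id|exact: cvg_cst].
    by move/(_ _ fg).
  by apply: filterS2 => y /= fgy; rewrite !fctE /= fgy fgx.
have E : 'd g x = 'd f x :> (V -> W) by have /= -> := diff_unique cd G.
split=> //; apply/diff_locallyP; rewrite E; split=> //.
Qed.

Lemma kdiff_eq (V W : normedModType R) k (U : set V) (f g : V -> W) :
  open U -> (forall x, U x -> f x = g x) -> kdiff k U f -> kdiff k U g.
Proof.
move=> oU; elim: k f g => //= k IH f g fg [df ddf].
have H x : U x -> differentiable g x /\ 'd g x = 'd f x :> (V -> W).
  move=> Ux; apply: near_eq_diff (df _ Ux).
  by apply: filterS (open_nbhs_nbhs (conj oU Ux)) => y Uy; apply: fg.
split=> [x /H[]//|v]; apply: IH (ddf v) => x Ux /=.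
by have [_ ->] := H _ Ux.
Qed.

Lemma kdiff_sub (V W : normedModType R) k (U U' : set V) (f : V -> W) :
  U' `<=` U -> kdiff k U f -> kdiff k U' f.
Proof.
by move=> sU; elim: k f => //= k IH f [df ddf]; split=> [x /sU/df//|v]; apply: IH.
Qed.

Lemma kdiffS (V W : normedModType R) k (U : set V) (f : V -> W) :
  kdiff k.+1 U f -> kdiff k U f.
Proof.
elim: k f => // k IH f [df ddf]; split=> // v; exact: IH (ddf v).
Qed.

Lemma kdiff_cst (V W : normedModType R) k (U : set V) (c : W) :
  kdiff k U (fun=> c).
Proof.
elim: k c => //= k IH c; split=> [x _|v]; first exact: differentiable_cst.
rewrite (_ : (fun _ => _) = (fun=> 0)); first exact: IH.
by apply/funext => x; have /= -> := @diff_cst R V W c x.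
Qed.

Lemma kdiffD (V W : normedModType R) k (U : set V) (f g : V -> W) : open U ->
  kdiff k U f -> kdiff k U g -> kdiff k U (fun x => f x + g x).
Proof.
move=> oU; elim: k f g => //= k IH f g [df ddf] [dg ddg].
split=> [x Ux|v]; first exact: differentiableD (df _ Ux) (dg _ Ux).
apply: kdiff_eq oU _ (IH _ _ (ddf v) (ddg v)) => x Ux /=.
by have /= -> := diffD (df _ Ux) (dg _ Ux).
Qed.

Lemma kdiff_sum (V W : normedModType R) k (U : set V) n (F : 'I_n -> V -> W) :
  open U -> (forall i, kdiff k U (F i)) -> kdiff k U (fun x => \sum_i F i x).
Proof.
move=> oU; elim: n F => [|n IH] F H.
  by apply: kdiff_eq oU _ (@kdiff_cst V W k U 0) => x _; rewrite big_ord0.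
have := kdiffD oU (IH (fun i => F (widen_ord (leqnSn n) i)) (fun i => H _)) (H ord_max).
by apply: (kdiff_eq oU) => x _; rewrite big_ord_recr.
Qed.

Lemma kdiffM (V : normedModType R) k (U : set V) (f g : V -> R) : open U ->
  kdiff k U f -> kdiff k U g -> kdiff k U (fun x => f x * g x).
Proof.
move=> oU; elim: k f g => // k IH f g kf kg.
have [df ddf] := kf; have [dg ddg] := kg.
split=> [x Ux|v]; first exact: differentiableM (df _ Ux) (dg _ Ux).
apply: kdiff_eq oU _ (kdiffD oU (IH _ _ (kdiffS kf) (ddg v))
  (IH _ _ (kdiffS kg) (ddf v))) => x Ux /=.
by have /= -> := diffM (df _ Ux) (dg _ Ux).
Qed.

Lemma kdiff_lin (V W Z : normedModType R) k (U : set V) (f : V -> W)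
    (L : {linear W -> Z}) : open U -> continuous L ->
  kdiff k U f -> kdiff k U (fun x => L (f x)).
Proof.
move=> oU cL; elim: k f => //= k IH f [df ddf].
have dL y : differentiable L y by exact: linear_differentiable.
split=> [x Ux|v]; first exact: differentiable_comp (df _ Ux) (dL _).
apply: kdiff_eq oU _ (IH _ (ddf v)) => x Ux /=.
have /= -> := diff_comp (df _ Ux) (dL _).
by have /= -> := diff_lin (f x) cL.
Qed.

Lemma kdiff_id (V : normedModType R) k (U : set V) : kdiff k U (@idfun V).
Proof.
case: k => //= k; split=> [x _|v]; first by have [] := is_diff_id x.
rewrite (_ : (fun _ => _) = (fun=> v)); first exact: kdiff_cst.
by apply/funext => x; have [_ /= ->] := is_diff_id x.
Qed.

Lemma kdiff_coord (V : normedModType R) m n k (U : set V) (f : V -> 'M[R]_(m, n)) i j :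
  open U -> kdiff k U f -> kdiff k U (fun x => f x i j).
Proof.
move=> oU kf.
have lc : linear (fun M : 'M[R]_(m, n) => M i j : R^o).
  by move=> a u v; rewrite !mxE.
pose L := GRing.isLinear.Build _ _ _ _ _ lc.
pose C : {linear 'M[R]_(m, n) -> R} := HB.pack (fun M : 'M[R]_(m, n) => M i j : R^o) L.
exact: (@kdiff_lin _ _ _ _ _ f C oU (@coord_continuous _ _ _ i j) kf).
Qed.

Lemma kdiff_scalel (V W : normedModType R) k (U : set V) (f : V -> R) (w : W) :
  open U -> kdiff k U f -> kdiff k U (fun x => f x *: w).
Proof.
move=> oU kf.
have lc : linear (fun a : R^o => a *: w).
  by move=> a u v; rewrite scalerDl scalerA.
pose L := GRing.isLinear.Build _ _ _ _ _ lc.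
pose C : {linear R -> W} := HB.pack (fun a : R^o => a *: w) L.
exact: (@kdiff_lin _ _ _ _ _ f C oU (@scalel_continuous _ _ w) kf).
Qed.

Lemma kdiff_comp_real (V : normedModType R) n k (U : set V) (U' : set 'rV[R]_n)
    (f : V -> 'rV[R]_n) (g : 'rV[R]_n -> R) : open U -> open U' ->
  (forall x, U x -> U' (f x)) ->
  kdiff k U f -> kdiff k U' g -> kdiff k U (fun x => g (f x)).
Proof.
move=> oU oU' fU; elim: k f g fU => // k IH f g fU kf kg.
have [df ddf] := kf; have [dg ddg] := kg.
split=> [x Ux|v]; first exact: differentiable_comp (df _ Ux) (dg _ (fU _ Ux)).
have := kdiff_sum oU (fun i : 'I_n => kdiffM oU
  (kdiff_coord 0 i oU (ddf v)) (IH _ _ fU (kdiffS kf) (ddg (delta_mx 0 i)))).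
apply: (kdiff_eq oU) => x Ux /=.
have /= -> := diff_comp (df _ Ux) (dg _ (fU _ Ux)).
rewrite [X in _ = 'd g _ X]row_sum_delta linear_sum.
by apply: eq_bigr => i _; rewrite linearZ.
Qed.

Lemma kdiff_comp (V : normedModType R) m n k (U : set V) (U' : set 'rV[R]_n)
    (f : V -> 'rV[R]_n) (g : 'rV[R]_n -> 'rV[R]_m) : open U -> open U' ->
  (forall x, U x -> U' (f x)) ->
  kdiff k U f -> kdiff k U' g -> kdiff k U (fun x => g (f x)).
Proof.
move=> oU oU' fU kf kg.
have := kdiff_sum oU (fun i : 'I_m => kdiff_scalel (delta_mx 0 i : 'rV[R]_m) oU
  (kdiff_comp_real oU oU' fU kf (kdiff_coord 0 i oU' kg))).
by apply: (kdiff_eq oU) => x Ux; rewrite [RHS]row_sum_delta.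
Qed.

Lemma smooth_continuous (V W : normedModType R) (U : set V) (f : V -> W) x :
  smooth_on U f -> U x -> {for x, continuous f}.
Proof. by move=> /(_ 1%N)[df _] /df; exact: differentiable_continuous. Qed.

End Smooth.

(* Parametrizations are partial functions, encoded with option, so that two of
   them are equal exactly when they have the same domain and the same values. *)
Definition pdom (A X : Type) (f : A -> option X) : set A := [set x | isSome (f x)].

Definition prestr (A X : Type) (V : set A) (f : A -> option X) : A -> option X :=
  fun x => if `[< V x >] then f x else None.

Lemma prestrT (A X : Type) (V : set A) (f : A -> option X) x :
  V x -> prestr V f x = f x.
Proof. by move=> Vx; rewrite /prestr (asboolT Vx). Qed.

Lemma prestrF (A X : Type) (V : set A) (f : A -> option X) x :
  ~ V x -> prestr V f x = None.
Proof. by move=> Vx; rewrite /prestr (asboolF Vx). Qed.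

Lemma pdom_restr (A X : Type) (V : set A) (f : A -> option X) :
  pdom (prestr V f) = V `&` pdom f.
Proof.
apply/funext => x; apply/propext; rewrite /pdom /=.
have [Vx|Vx] := pselect (V x); first by rewrite prestrT //; split=> [|[]].
by rewrite prestrF //; split=> // -[].
Qed.

Lemma prestr_omap (A X Y : Type) (V : set A) (f : A -> option X) (g : X -> Y) :
  omap g \o prestr V f = prestr V (omap g \o f).
Proof. by apply/funext => x; rewrite /prestr /=; case: asbool. Qed.

Lemma pdom_omap (A X Y : Type) (f : A -> option X) (g : X -> Y) :
  pdom (omap g \o f) = pdom f.
Proof. by apply/funext => x; rewrite /pdom /=; case: (f x). Qed.

Lemma prestr_dom (A X : Type) (V : set A) (f : A -> option X) :
  pdom f `<=` V -> prestr V f = f.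
Proof.
move=> fV; apply/funext => x; have [Vx|Vx] := pselect (V x); first exact: prestrT.
rewrite prestrF //; case E : (f x) => [y|//].
by case: Vx; apply: fV; rewrite /pdom /= E.
Qed.

Lemma prestr_id (A X : Type) (V : set A) (f : A -> option X) :
  prestr V f = prestr (V `&` pdom f) f.
Proof.
apply/funext => x; have [[Vx fx]|nV] := pselect ((V `&` pdom f) x).
  by rewrite !prestrT //; split.
rewrite [RHS]prestrF //; have [Vx|Vx] := pselect (V x); last exact: prestrF.
rewrite prestrT //; case E : (f x) => [y|//].
by case: nV; split=> //; rewrite /pdom /= E.
Qed.

Lemma prestr_prestr (A X : Type) (V W : set A) (f : A -> option X) :
  prestr V (prestr W f) = prestr (V `&` W) f.
Proof.
apply/funext => x; have [Vx|Vx] := pselect (V x); last first.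
  by rewrite !prestrF // => -[].
rewrite prestrT //; have [Wx|Wx] := pselect (W x).
  by rewrite !prestrT //; split.
by rewrite !prestrF // => -[].
Qed.

Section Diffeology.
Context {R : realType}.

Record diffSpace := DiffSpace {
  carrier :> Type;
  plot : forall n, ('rV[R]_n -> option carrier) -> Prop;
  plot_open : forall n (f : 'rV[R]_n -> option carrier),
    plot f -> open (pdom f);
  plot_cst : forall n (x : carrier), plot (fun _ : 'rV[R]_n => Some x);
  plot_loc : forall n (f : 'rV[R]_n -> option carrier),
    (forall r, pdom f r -> exists2 V, open_nbhs r V & plot (prestr V f)) ->
    plot f;
  plot_comp : forall m n (f : 'rV[R]_n -> option carrier)
      (V : set 'rV[R]_m) (h : 'rV[R]_m -> 'rV[R]_n),
    plot f -> open V -> smooth_on V h -> (forall r, V r -> pdom f (h r)) ->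
    plot (prestr V (fun r => f (h r))) }.

Lemma plot_restr (X : diffSpace) n (f : 'rV[R]_n -> option X) V :
  plot f -> open V -> plot (prestr V f).
Proof.
move=> pf oV; rewrite prestr_id.
apply: (@plot_comp X n n f (V `&` pdom f) idfun pf).
- exact: openI oV (plot_open pf).
- by move=> k; apply: kdiff_id.
- by move=> r [].
Qed.

Lemma open_pdom_loc (Y : Type) n (f : 'rV[R]_n -> option Y) :
  (forall r, pdom f r ->
    exists2 V : set 'rV[R]_n, open_nbhs r V & open (pdom (prestr V f))) ->
  open (pdom f).
Proof.
move=> H; rewrite openE => r fr; have [V [oV Vr]] := H r fr.
rewrite pdom_restr => oVf.
have := open_nbhs_nbhs (conj oVf (conj Vr fr)).
by apply: filterS => y [].
Qed.

Definition smooth_map (X Y : diffSpace) (f : X -> Y) :=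
  forall n (p : 'rV[R]_n -> option X), plot p -> plot (omap f \o p).

Lemma kdiff_loc (V W : normedModType R) k (U : set V) (f : V -> W) :
  (forall x, U x -> exists2 A, open_nbhs x A & kdiff k (A `&` U) f) ->
  kdiff k U f.
Proof.
elim: k f => //= k IH f H; split=> [x Ux|v].
  by have [A [oA Ax] [df _]] := H x Ux; apply: df.
by apply: IH => x Ux; have [A oA [_ ddf]] := H x Ux; exists A.
Qed.

Definition real_plot n (p : 'rV[R]_n -> option R) :=
  open (pdom p) /\ smooth_on (pdom p) (fun r => odflt 0 (p r)).

Lemma real_plot_cst n (x : R) : real_plot (fun _ : 'rV[R]_n => Some x).
Proof.
split=> [|k]; last exact: kdiff_cst.
by rewrite (_ : pdom _ = setT); [exact: openT|apply/funext => r; apply/propext].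
Qed.

Lemma real_plot_loc n (f : 'rV[R]_n -> option R) :
  (forall r, pdom f r -> exists2 V, open_nbhs r V & real_plot (prestr V f)) ->
  real_plot f.
Proof.
move=> H; have of_ : open (pdom f).
  by apply: open_pdom_loc => r /H[V oV []]; exists V.
split=> // k; apply: kdiff_loc => r /H[V [oV Vr] [oVf sVf]]; exists V => //.
have := sVf k; rewrite pdom_restr; apply: kdiff_eq; first exact: openI.
by move=> x [Vx _]; rewrite prestrT.
Qed.

Lemma real_plot_comp m n (f : 'rV[R]_n -> option R)
      (V : set 'rV[R]_m) (h : 'rV[R]_m -> 'rV[R]_n) :
    real_plot f -> open V -> smooth_on V h -> (forall r, V r -> pdom f (h r)) ->
    real_plot (prestr V (fun r => f (h r))).
Proof.
move=> [of_ sf] oV sh hV; rewrite /real_plot.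
have -> : pdom (prestr V (fun r => f (h r))) = V.
  by rewrite pdom_restr; apply/funext => r; apply/propext; split=> [[]|Vr] //; split=> //; exact: hV.
split=> // k; apply: kdiff_eq oV _ (kdiff_comp_real oV of_ hV (sh k) (sf k)) => r Vr.
by rewrite prestrT.
Qed.

Definition real_diff : diffSpace :=
  @DiffSpace R real_plot (fun n f => @proj1 _ _) real_plot_cst real_plot_loc
    real_plot_comp.

Definition sub_diff (X : diffSpace) (P : set X) : diffSpace.
Proof.
refine (@DiffSpace {x : X | P x}
  (fun n p => plot (omap sval \o p)) _ _ _ _).
- by move=> n f /plot_open; rewrite pdom_omap.
- by move=> n x; exact: plot_cst (sval x).
- move=> n f H; apply: plot_loc => r; rewrite pdom_omap => /H[V oV].
  by rewrite prestr_omap; exists V.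
- move=> m n f V h pf oV sh hV; rewrite prestr_omap.
  by apply: (plot_comp pf) => // r; rewrite pdom_omap => /hV.
Defined.

Section Quotient.
Variables (X : diffSpace) (r : X -> X -> Prop).

(* Equivalence classes; r is an equivalence relation in all uses. *)
Definition quot := {A : set X | exists x, A = r x}.

Definition qcls (x : X) : quot := exist _ (r x : set X) (ex_intro _ x erefl).

Lemma qcls_surj (c : quot) : exists x, c = qcls x.
Proof. by case: c => A [x Ax]; exists x; apply: eq_exist. Qed.

Definition quot_plot n (p : 'rV[R]_n -> option quot) :=
  forall s, pdom p s -> exists (V : set 'rV[R]_n) (q : 'rV[R]_n -> option X),
    [/\ open_nbhs s V, plot q & prestr V p = omap qcls \o q].

Lemma quot_plot_open n (p : 'rV[R]_n -> option quot) :
  quot_plot p -> open (pdom p).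
Proof.
move=> H; apply: open_pdom_loc => s /H[V [q [oV pq E]]]; exists V => //.
by rewrite E pdom_omap; exact: plot_open.
Qed.

Definition quot_diff : diffSpace.
Proof.
refine (@DiffSpace quot quot_plot quot_plot_open _ _ _).
- move=> n c s _; have [x ->] := qcls_surj c.
  exists setT, (fun=> Some x); split.
  + by split=> //; exact: openT.
  + exact: plot_cst.
  + by rewrite prestr_dom.
- move=> n f H s fs; have [V [oV Vs] /(_ s)] := H s fs.
  rewrite pdom_restr => /(_ (conj Vs fs))[W [q [[oW Ws] pq E]]].
  exists (W `&` V), q; split=> //.
    by split; [exact: openI|].
  by rewrite -E prestr_prestr.
- move=> m n f V h pf oV sh hV s; rewrite pdom_restr => -[Vs fs].
  have [W [q [[oW Ws] pq E]]] := pf _ fs.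
  have oVW : open (V `&` h @^-1` W).
    rewrite openE => x [Vx Wx]; apply: filterI.
      exact: open_nbhs_nbhs (conj oV Vx).
    have := smooth_continuous sh Vx.
    by apply; apply: open_nbhs_nbhs.
  exists (V `&` h @^-1` W), (prestr (V `&` h @^-1` W) (fun x => q (h x))); split.
  + by split.
  + apply: plot_comp => //.
      by move=> k; apply: kdiff_sub (sh k) => x [].
    move=> x [Vx Wx]; have := congr1 (fun g => isSome (g (h x))) E.
    rewrite prestrT //= /pdom /=; have := hV _ Vx; rewrite /pdom /=.
    by case: (q (h x)) => //= ->.
  + rewrite prestr_prestr prestr_omap setIAC setIid; apply/funext => x.
    have [[Vx Wx]|nx] := pselect ((V `&` h @^-1` W) x); last by rewrite !prestrF.
    rewrite !prestrT //=; have := congr1 (fun g => g (h x)) E.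
    by rewrite prestrT.
Defined.
End Quotient.

Section Functional.
Variables (X Y : diffSpace).

Definition smap := {f : X -> Y | smooth_map f}.

(* [fun_plot p] says that (s, x) |-> p s x is smooth on pdom p * X: a plot of
   that product is a pair of a smooth u : V -> pdom p and a plot q of X. *)
Definition eval_along m n (p : 'rV[R]_n -> option smap) (u : 'rV[R]_m -> 'rV[R]_n)
    (q : 'rV[R]_m -> option X) : 'rV[R]_m -> option Y :=
  fun w => if p (u w) is Some f then omap (sval f) (q w) else None.

Definition fun_plot n (p : 'rV[R]_n -> option smap) :=
  open (pdom p) /\
  forall m (V : set 'rV[R]_m) (u : 'rV[R]_m -> 'rV[R]_n) (q : 'rV[R]_m -> option X),
    open V -> smooth_on V u -> (forall w, V w -> pdom p (u w)) -> plot q ->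
    plot (prestr V (eval_along p u q)).

Definition fun_diff : diffSpace.
Proof.
refine (@DiffSpace smap fun_plot (fun n f => @proj1 _ _) _ _ _).
- move=> n f; split.
    by rewrite (_ : pdom _ = setT); [exact: openT|apply/funext => r; apply/propext].
  move=> m V u q oV su uV pq; apply: plot_restr => //.
  exact: (svalP f).
- move=> n f H; have of_ : open (pdom f).
    by apply: open_pdom_loc => r /H[V oV []]; exists V.
  split=> // m V u q oV su uV pq; apply: plot_loc => w; rewrite pdom_restr => -[Vw _].
  have [W [oW Ww] [_ pW]] := H _ (uV _ Vw).
  have oVW : open (V `&` u @^-1` W).
    rewrite openE => x [Vx Wx]; apply: filterI.
      exact: open_nbhs_nbhs (conj oV Vx).
    have := smooth_continuous su Vx.
    by apply; apply: open_nbhs_nbhs.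
  exists (V `&` u @^-1` W) => //.
  have := pW m (V `&` u @^-1` W) u q oVW _ _ pq.
  rewrite prestr_prestr setIAC setIid.
  rewrite (_ : prestr _ (eval_along _ _ _) = prestr (V `&` u @^-1` W) (eval_along f u q)).
    apply; first by move=> k; apply: kdiff_sub (su k) => x [].
    by move=> x [Vx Wx]; rewrite pdom_restr; split=> //; exact: uV.
  apply/funext => x.
  have [[Vx Wx]|nx] := pselect ((V `&` u @^-1` W) x); last by rewrite !prestrF.
  by rewrite !prestrT // /eval_along prestrT.
- move=> m n f V h [of_ pf] oV sh hV.
  have dE : pdom (prestr V (fun r => f (h r))) = V.
    by rewrite pdom_restr; apply/funext => r; apply/propext; split=> [[]|Vr] //; split=> //; exact: hV.
  split; first by rewrite dE.
  move=> l W u q oW su; rewrite dE => uV pq.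
  have := pf l W (fun w => h (u w)) q oW _ _ pq.
  rewrite (_ : prestr W (eval_along _ u q) = prestr W (eval_along f (fun w => h (u w)) q)).
    apply; last by move=> w Ww; apply: hV; apply: uV.
    by move=> k; apply: (kdiff_comp oW oV uV (su k) (sh k)).
  apply/funext => x; have [Wx|nx] := pselect (W x); last by rewrite !prestrF.
  by rewrite !prestrT // /eval_along prestrT //; exact: uV.
Defined.
End Functional.
End Diffeology.
Arguments diffSpace R : clear implicits.

Section Interval.
Context {R : realType}.

Definition unitI : diffSpace R := sub_diff (X := real_diff) [set t : R | 0 <= t <= 1].

Definition Ival (t : unitI) : R := sval t.

Lemma Ival_bound (t : unitI) : 0 <= Ival t <= 1. Proof. exact: (svalP t). Qed.

Lemma clamp_subproof (x : R) : 0 <= Num.max 0 (Num.min x 1) <= 1.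
Proof. by rewrite le_max lexx /= ge_max ler01 ge_min lexx orbT. Qed.

(* Only ever evaluated at points of [0, 1]. *)
Definition clamp (x : R) : unitI :=
  exist (fun t : R => 0 <= t <= 1) (Num.max 0 (Num.min x 1)) (clamp_subproof x).

Lemma clampK x : 0 <= x <= 1 -> Ival (clamp x) = x.
Proof. by move=> /andP[x0 x1]; rewrite /Ival /= min_l // max_r. Qed.

Lemma IvalK t : clamp (Ival t) = t.
Proof.
by case: t => x hx; apply: eq_exist; have := clampK hx; rewrite /Ival.
Qed.

Lemma Ival_inj : injective Ival.
Proof. by move=> s t st; rewrite -(IvalK s) st IvalK. Qed.

Definition I0 : unitI := clamp 0.
Definition I1 : unitI := clamp 1.

Lemma I0E : Ival I0 = 0. Proof. by rewrite clampK // lexx ler01. Qed.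
Lemma I1E : Ival I1 = 1. Proof. by rewrite clampK // lexx ler01. Qed.

Lemma open_preim_smooth (V W : normedModType R) (U : set V) (f : V -> W) B :
  open U -> smooth_on U f -> open B -> open (U `&` f @^-1` B).
Proof.
move=> oU sf oB; rewrite openE => x [Ux Bx]; apply: filterI.
  exact: open_nbhs_nbhs (conj oU Ux).
have := smooth_continuous sf Ux.
by apply; apply: open_nbhs_nbhs.
Qed.

Definition qval n (q : 'rV[R]_n -> option unitI) w : R :=
  if q w is Some t then Ival t else 0.

Lemma qval_smooth n (q : 'rV[R]_n -> option unitI) :
  plot q -> smooth_on (pdom q) (qval q).
Proof.
move=> [oq sq] k; have := sq k; rewrite pdom_omap in oq *.
by apply: kdiff_eq oq _ => w _; rewrite /qval /=; case: (q w).
Qed.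

Lemma unitI_plot n (V : set 'rV[R]_n) (g : 'rV[R]_n -> R) :
  open V -> smooth_on V g -> (forall w, V w -> 0 <= g w <= 1) ->
  plot (prestr V (fun w => Some (clamp (g w)))).
Proof.
move=> oV sg gV; rewrite /= /real_plot pdom_omap.
have -> : pdom (prestr V (fun w => Some (clamp (g w)))) = V.
  by rewrite pdom_restr; apply/funext => w; apply/propext; split=> [[]|].
split=> // k; apply: kdiff_eq oV _ (sg k) => w Vw /=.
by rewrite prestrT //= -[LHS](clampK (gV w Vw)).
Qed.

Lemma plot_ext (X : diffSpace R) n (f : 'rV[R]_n -> option X) :
  plot f -> forall g, f = g -> plot g.
Proof. by move=> pf g <-. Qed.

Lemma smooth_id (X : diffSpace R) : smooth_map (@idfun X).
Proof.
move=> n p pp; rewrite (_ : omap idfun \o p = p) //.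
by apply/funext => w /=; case: (p w).
Qed.

Definition id_map (X : diffSpace R) : smap X X := exist _ idfun (@smooth_id X).

Lemma smooth_comp (X Y Z : diffSpace R) (g : Y -> Z) (f : X -> Y) :
  smooth_map g -> smooth_map f -> smooth_map (g \o f).
Proof.
move=> sg sf n p /sf/sg; rewrite (_ : omap g \o _ = omap (g \o f) \o p) //.
by apply/funext => w /=; case: (p w).
Qed.

Definition comp_map (X Y Z : diffSpace R) (g : smap Y Z) (f : smap X Y) : smap X Z :=
  exist _ _ (smooth_comp (svalP g) (svalP f)).

End Interval.

Definition oval (T : Type) (o : option T) : isSome o -> T :=
  match o with
  | Some x => fun=> x
  | None => fun h => False_rect T (notF h)
  end.

Lemma ovalE (T : Type) (o : option T) (h : isSome o) : Some (oval h) = o.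
Proof. by case: o h. Qed.

Lemma oval_eq (T : Type) (o : option T) (h : isSome o) x : o = Some x -> oval h = x.
Proof. by move=> e; apply: Some_inj; rewrite ovalE. Qed.

Section Paths.
Context {R : realType}.
Implicit Types X Y E : diffSpace R.

(* Smooth paths: one-dimensional plots whose (open) domain is an interval,
   'rV[R]_1 being identified with R. *)
Record smooth_path Y := Path {
  path_fun :> R -> option Y;
  path_plot : plot (fun r : 'rV[R]_1 => path_fun (r 0 0));
  path_itv : is_interval (pdom path_fun) }.

Lemma path_eq Y (c d : smooth_path Y) : (forall t, c t = d t) -> c = d.
Proof.
case: c d => [c cp ci] [d dp di] /= /funext cd.
by case: d / cd dp di => dp di; rewrite (Prop_irrelevance cp dp) (Prop_irrelevance ci di).
Qed.

Definition phat Y := {ct : smooth_path Y * R | pdom ct.1 ct.2}.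

Definition path_connected X :=
  forall x y : X, exists (c : smooth_path X) s t, c s = Some x /\ c t = Some y.

Lemma path_map_plot X Y (f : X -> Y) (c : smooth_path X) : smooth_map f ->
  plot (fun r : 'rV[R]_1 => (omap f \o c) (r 0 0)).
Proof. by move=> sf; apply: (sf 1%N) (path_plot c). Qed.

Lemma path_map_itv X Y (f : X -> Y) (c : smooth_path X) : is_interval (pdom (omap f \o c)).
Proof. by rewrite pdom_omap; exact: path_itv. Qed.

Definition path_map X Y (f : smap X Y) (c : smooth_path X) : smooth_path Y :=
  Path (path_map_plot c (svalP f)) (@path_map_itv X Y (sval f) c).

Section Lifts.
Variables (E X : diffSpace R) (pi : E -> X) (A : phat E -> smooth_path E).

Definition horizontal (c : smooth_path E) := exists t (h : pdom c t), A (exist _ (c, t) h) = c.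

Definition lift_at (a : smooth_path X) t (xi : E) (l : smooth_path E) :=
  omap pi \o l = a /\ l t = Some xi.

(* [is_hor a t xi c] is hor_A(a, t, xi) = c: the lifts of a through xi at t
   exist, and A_t sends each of them to the A-horizontal path c. *)
Definition is_hor (a : smooth_path X) t (xi : E) (c : smooth_path E) :=
  [/\ horizontal c, exists l, lift_at a t xi l &
      forall (l : smooth_path E) (h : pdom l t), lift_at a t xi l -> A (exist _ (l, t) h) = c].
End Lifts.

Lemma seg_dom X (c : smooth_path X) r s (t : unitI) : pdom c r -> pdom c s ->
  pdom c (Ival t * s + (1 - Ival t) * r).
Proof.
move=> cr cs; have /andP[t0 t1] := Ival_bound t.
have [rs|sr] := leP r s.
- by apply: (path_itv cr cs); apply/andP; split; nra.
- by apply: (path_itv cs cr); apply/andP; split; nra.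
Qed.

Lemma seg_family_plot X (c : smooth_path X) (r : R) (phi : unitI -> unitI) m
    (V : set 'rV[R]_m) (s : 'rV[R]_m -> R) (q : 'rV[R]_m -> option unitI) :
  pdom c r -> smooth_map phi -> open V -> smooth_on V s ->
  (forall w, V w -> pdom c (s w)) -> plot q ->
  plot (prestr V (fun w => if q w is Some t
    then c (Ival (phi t) * s w + (1 - Ival (phi t)) * r) else None)).
Proof.
move=> cr sphi oV ss sV pq.
have pq' := sphi _ _ pq; set q' := omap phi \o q in pq'.
pose h (w : 'rV[R]_m) : 'rV[R]_1 :=
  (qval q' w * s w + (1 + (- 1) * qval q' w) * r) *: const_mx 1.
have oW : open (V `&` pdom q') by apply: openI => //; exact: plot_open pq'.
have := @plot_comp _ X m 1 _ (V `&` pdom q') h (path_plot c) oW.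
rewrite (_ : prestr (V `&` pdom q') _ = prestr V (fun w => if q w is Some t
    then c (Ival (phi t) * s w + (1 - Ival (phi t)) * r) else None)).
  apply.
    have sq k : kdiff k (V `&` pdom q') (qval q').
      by apply: kdiff_sub (qval_smooth pq' k) => w [].
    have ss' k : kdiff k (V `&` pdom q') s by apply: kdiff_sub (ss k) => w [].
    move=> k; apply: kdiff_scalel => //; apply: kdiffD => //; first exact: kdiffM.
    apply: kdiffM => //; last exact: kdiff_cst.
    apply: kdiffD => //; first exact: kdiff_cst.
    by apply: kdiffM => //; exact: kdiff_cst.
  move=> w [Vw]; rewrite pdom_omap /pdom /= /h /qval /q' !mxE mulr1 mulN1r /=.
  by case: (q w) => //= t _; apply: seg_dom => //; exact: sV.
rewrite (prestr_id V); rewrite [X in _ = prestr X _](_ : _ = V `&` pdom q').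
  apply/funext => w.
  have [[Vw qw]|nw] := pselect ((V `&` pdom q') w); last by rewrite !prestrF.
  rewrite !prestrT //; move: qw; rewrite pdom_omap /pdom /= /h /qval /q' !mxE mulr1 mulN1r /=.
  by case: (q w).
apply/funext => w; apply/propext; rewrite pdom_omap /pdom /=; split=> -[Vw];
  case: (q w) => //= t _; split=> //.
by apply: seg_dom => //; exact: sV.
Qed.

(* c^{r -> s} *)
Definition seg_fun X (c : smooth_path X) r s (hr : pdom c r) (hs : pdom c s) (t : unitI) : X :=
  oval (seg_dom t hr hs).

Lemma seg_smooth X (c : smooth_path X) r s (hr : pdom c r) (hs : pdom c s) :
  smooth_map (seg_fun hr hs).
Proof.
move=> n q pq.
have := @seg_family_plot X c r idfun n setT (fun=> s) q hr (@smooth_id _ _) openT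
  (fun k => kdiff_cst k _ s) (fun w _ => hs) pq.
rewrite prestr_dom // (_ : (fun w => _) = omap (seg_fun hr hs) \o q) //.
by apply/funext => w /=; case: (q w) => //= t; rewrite /seg_fun ovalE.
Qed.

Definition seg X (c : smooth_path X) r s (hr : pdom c r) (hs : pdom c s) : smap unitI X :=
  exist _ _ (seg_smooth hr hs).

End Paths.

Section PathSpace.
Context {R : realType}.
Variable X : diffSpace R.

Definition Cinf := fun_diff (@unitI R) X.
Implicit Types a b : Cinf.
Let I := @unitI R.

Definition cst_near_ends (Y : Type) (a : I -> Y) := exists2 e : R, 0 < e &
  forall t, (Ival t < e -> a t = a I0) /\ (1 - e < Ival t -> a t = a I1).

(* b \/ a: first a, then b. *)
Definition catf (b a : I -> X) : I -> X := fun t =>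
  if Ival t < 2^-1 then a (clamp (2 * Ival t)) else b (clamp (2 * Ival t - 1)).

Definition revf (a : I -> X) : I -> X := fun t => a (clamp (1 - Ival t)).

Definition reparam a b := exists f g : smap I I,
  [/\ cancel (sval f) (sval g), cancel (sval g) (sval f),
      sval f I0 = I0, sval f I1 = I1 & sval a = sval b \o sval f].

Definition Cinf_sim := quot_diff reparam.

(* b \/ a  |->  b \/ e \/ e^<- \/ a, the representatives b, e, a being constant
   near 0 and 1, as concatenation requires. *)
Definition retrace_step (x y : Cinf_sim) := exists b e a p q : Cinf,
  [/\ [/\ cst_near_ends (sval b), cst_near_ends (sval e) & cst_near_ends (sval a)],
      sval b I0 = sval a I1, sval e I1 = sval a I1,
      sval p = catf (sval b) (sval a) /\
      sval q = catf (sval b) (catf (sval e) (catf (revf (sval e)) (sval a))) &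
      x = qcls reparam p /\ y = qcls reparam q].

Definition retrace := clos_refl_sym_trans Cinf_sim retrace_step.

Definition Fspace := quot_diff retrace.

Definition Fcls a : Fspace := qcls retrace (qcls reparam a).

Lemma catf0 (b a : I -> X) : catf b a I0 = a I0.
Proof. by rewrite /catf I0E invr_gt0 ltr0n mulr0. Qed.

Lemma catf1 (b a : I -> X) : catf b a I1 = b I1.
Proof.
rewrite /catf I1E ltNge invf_le1 ?ler1n //= mulr1.
by congr (b (clamp _)); lra.
Qed.

Lemma plot_catf m (V : set 'rV[R]_m) (q : 'rV[R]_m -> option I)
    (b : 'rV[R]_m -> I -> X) (a : I -> X) e : 0 < e ->
  open V -> plot q -> smooth_map a ->
  (forall w t, V w -> Ival t < e -> b w t = a I1) ->
  (forall t, 1 - e < Ival t -> a t = a I1) ->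
  (forall q', plot q' -> plot (prestr V (fun w => omap (b w) (q' w)))) ->
  plot (prestr V (fun w => omap (catf (b w) a) (q w))).
Proof.
move=> e0 oV pq sa be ae pb.
have oq := plot_open pq; have sq := qval_smooth pq.
pose Q B := pdom q `&` qval q @^-1` B.
have oQ B : open B -> open (Q B) by move=> oB; exact: open_preim_smooth.
have kQ B k : kdiff k (Q B) (qval q) by apply: kdiff_sub (sq k) => w [].
apply: plot_loc => w0; rewrite pdom_restr => -[Vw0]; rewrite /pdom /=.
case E0 : (q w0) => [t0|//] _.
have qw0 : qval q w0 = Ival t0 by rewrite /qval E0.
have dw0 : pdom q w0 by rewrite /pdom /= E0.
have qb w t : q w = Some t -> qval q w = Ival t by rewrite /qval => ->.
have qd w : pdom q w -> exists t, q w = Some t.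
  by rewrite /pdom /=; case: (q w) => // t _; exists t.
case: (ltgtP (Ival t0) 2^-1) => ht0.
- pose B : set R := [set x | x < 2^-1].
  have oB : open B by exact: open_lt.
  exists (Q B); first by split; [exact: oQ|split=> //=; rewrite /B /= qw0].
  have H : plot (prestr (Q B) (fun w => Some (clamp (2 * qval q w)))).
    apply: unitI_plot; first exact: oQ.
      by move=> k; apply: kdiffM; [exact: oQ|exact: kdiff_cst|exact: kQ].
    move=> w [/qd[t qt]]; rewrite /B /= (qb _ _ qt).
    by have /andP[? ?] := Ival_bound t; move=> ?; apply/andP; split; lra.
  have := plot_restr (sa _ _ H) oV.
  rewrite prestr_prestr prestr_omap prestr_prestr setIC.
  move/plot_ext; apply.
  apply/funext => w; have [[Qw Vw]|nw] := pselect ((Q B `&` V) w); last by rewrite !prestrF.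
  rewrite !prestrT //=; case: Qw => /qd[t qt]; rewrite /B /= (qb _ _ qt) qt /= /catf.
  by move=> ->.
- pose B : set R := [set x | 2^-1 < x].
  have oB : open B by exact: open_gt.
  exists (Q B); first by split; [exact: oQ|split=> //=; rewrite /B /= qw0].
  have H : plot (prestr (Q B) (fun w => Some (clamp (2 * qval q w + - 1)))).
    apply: unitI_plot; first exact: oQ.
      move=> k; apply: kdiffD; [exact: oQ| |exact: kdiff_cst].
      by apply: kdiffM; [exact: oQ|exact: kdiff_cst|exact: kQ].
    move=> w [/qd[t qt]]; rewrite /B /= (qb _ _ qt).
    by have /andP[? ?] := Ival_bound t; move=> ?; apply/andP; split; lra.
  have := plot_restr (pb _ H) (oQ _ oB).
  rewrite prestr_prestr.
  move/plot_ext; apply.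
  rewrite prestr_prestr.
  apply/funext => w; have [[Qw Vw]|nw] := pselect ((Q B `&` V) w); last by rewrite !prestrF.
  rewrite !prestrT //=; case: Qw => /qd[t qt]; rewrite /B /= (qb _ _ qt) qt /= /catf.
  by move=> h; rewrite ltNge (ltW h).
- pose B : set R := [set x | 2^-1 - e / 2 < x] `&` [set x | x < 2^-1 + e / 2].
  have oB : open B by apply: openI; [exact: open_gt|exact: open_lt].
  exists (Q B).
    by split; [exact: oQ|split=> //=; split; rewrite /= qw0 ht0; lra].
  have := plot_restr (plot_cst m (a I1)) (openI (oQ _ oB) oV).
  rewrite prestr_prestr.
  move/plot_ext; apply.
  apply/funext => w; have [[Qw Vw]|nw] := pselect ((Q B `&` V) w); last by rewrite !prestrF.
  rewrite !prestrT //=; case: Qw => /qd[t qt]; rewrite /B /= (qb _ _ qt) qt /= /catf.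
  have /andP[? ?] := Ival_bound t; move=> [l1 l2]; case: ltP => ht; congr Some.
    by rewrite ae // clampK; [|apply/andP; split]; lra.
  by rewrite (be w) // clampK; [|apply/andP; split]; lra.
Qed.

Lemma catf_smooth b a : cst_near_ends (sval b) -> cst_near_ends (sval a) ->
  sval b I0 = sval a I1 -> smooth_map (catf (sval b) (sval a)).
Proof.
move=> [e e0 hb] [d d0 ha] ba n q pq.
have := @plot_catf n setT q (fun=> sval b) (sval a) (Num.min e d).
rewrite prestr_dom //; apply=> //.
- by rewrite lt_min e0.
- exact: openT.
- exact: (svalP a).
- by move=> _ t _; rewrite lt_min => /andP[/(hb t).1 -> _].
- move=> t h; apply: (ha t).2; apply: le_lt_trans h.
  by rewrite lerD2l lerN2 ge_min lexx orbT.
- by move=> q' pq'; rewrite prestr_dom //; exact: (svalP b).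
Qed.

Definition cat b a (hb : cst_near_ends (sval b)) (ha : cst_near_ends (sval a))
  (hba : sval b I0 = sval a I1) : Cinf := exist _ _ (catf_smooth hb ha hba).

Lemma catf_ends (b a : I -> X) :
  cst_near_ends b -> cst_near_ends a -> cst_near_ends (catf b a).
Proof.
move=> [e e0 hb] [d d0 ha]; exists (Num.min (Num.min e d / 2) 2^-1).
  by rewrite lt_min divr_gt0 ?lt_min ?e0 ?d0 // invr_gt0 ltr0n.
move=> t; have /andP[t0 t1] := Ival_bound t.
rewrite catf0 catf1; split=> h.
  move: h; rewrite lt_min => /andP[h1 h2]; rewrite /catf h2.
  apply: (ha _).1; rewrite clampK; last by apply/andP; split; lra.
  by have : Num.min e d <= d by [rewrite ge_min lexx orbT]; lra.
have h1 : 1 - 2^-1 < Ival t.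
  by apply: le_lt_trans h; rewrite lerD2l lerN2 ge_min lexx orbT.
have h2 : 1 - Num.min e d / 2 < Ival t.
  by apply: le_lt_trans h; rewrite lerD2l lerN2 ge_min lexx.
rewrite /catf ltNge (_ : 2^-1 <= Ival t) /=; last lra.
apply: (hb _).2; rewrite clampK; last by apply/andP; split; lra.
by have : Num.min e d <= e by [rewrite ge_min lexx]; lra.
Qed.

Lemma qclsP (Y : diffSpace R) (r : Y -> Y -> Prop) x y :
  (forall z, r z z) -> qcls r x = qcls r y -> r x y.
Proof.
by move=> rr /(congr1 sval) /= E; rewrite E.
Qed.

Lemma reparam_refl a : reparam a a.
Proof. by exists (id_map _), (id_map _). Qed.

Lemma reparam_end a b : reparam a b -> sval a I1 = sval b I1.
Proof. by move=> [f [g [_ _ _ f1 ->]]] /=; rewrite f1. Qed.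

Lemma retrace_end x y : retrace x y ->
  forall a b, x = qcls reparam a -> y = qcls reparam b -> sval a I1 = sval b I1.
Proof.
elim=> [{}x {}y [b [e [a [p [q [_ _ _ [Ep Eq] [-> ->]]]]]]]|{}x|{}x {}y _ IH|{}x {}y z _ IH1 _ IH2].
- move=> a' b' /(qclsP reparam_refl)/reparam_end <- /(qclsP reparam_refl)/reparam_end <-.
  by rewrite Ep Eq !catf1.
- by move=> a b -> /(qclsP reparam_refl)/reparam_end.
- by move=> a b ya xb; rewrite (IH b a).
- move=> a b xa zb; have [c yc] := qcls_surj y.
  by rewrite (IH1 a c) // (IH2 c b).
Qed.

Lemma retrace_refl x : retrace x x. Proof. exact: rst_refl. Qed.

Lemma Fcls_end a b : Fcls a = Fcls b -> sval a I1 = sval b I1.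
Proof.
move=> /(qclsP retrace_refl) h; exact: retrace_end h _ _ erefl erefl.
Qed.

Variable x0 : X.

(* Classes in F(X) are taken with representatives constant near 0 and 1. *)
Definition based a := cst_near_ends (sval a) /\ sval a I0 = x0.

Definition pointedF := sub_diff (X := Fspace) [set xi | exists2 a, based a & xi = Fcls a].

Definition class_of_based a (h : based a) : pointedF := exist _ _ (ex_intro2 _ _ a h erefl).

Definition rep (xi : pointedF) : Cinf := s2val (cid2 (svalP xi)).

Lemma rep_based xi : based (rep xi).
Proof. exact: (s2valP (cid2 (svalP xi))). Qed.

Lemma repK xi : class_of_based (rep_based xi) = xi.
Proof.
have : sval (class_of_based (rep_based xi)) = sval xi by exact: (esym (s2valP' (cid2 (svalP xi)))).
by move: (class_of_based _) => [u hu]; case: xi => v hv /= uv; exact: eq_exist.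
Qed.

Definition tau (xi : pointedF) : X := sval (rep xi) I1.

Lemma tau_class a (h : based a) : tau (class_of_based h) = sval a I1.
Proof.
apply: Fcls_end; have := congr1 sval (repK (class_of_based h)); exact.
Qed.

Lemma tau_smooth : smooth_map tau.
Proof.
move=> n p pp; apply: plot_loc => s; rewrite pdom_omap => ps.
have := pp s; rewrite pdom_omap => /(_ ps)[V [q [[oV Vs] pq E]]].
have qs : pdom q s.
  have := congr1 (fun g => isSome (g s)) E.
  by rewrite prestrT // /pdom /=; move: ps; rewrite /pdom /=; case: (p s) => //= ? _; case: (q s).
have [W [q2 [[oW Ws] [oq2 pq2] E2]]] := pq s qs.
exists (V `&` W); first by split; [exact: openI|].
have := pq2 n (V `&` W `&` pdom q2) idfun (fun=> Some I1) (openI (openI oV oW) oq2)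
  (fun k => kdiff_id k _) (fun w => @proj2 _ _) (plot_cst _ _).
move/plot_ext; apply.
have dE w : (V `&` W) w -> forall xi, p w = Some xi ->
    exists2 a, q2 w = Some a & tau xi = sval a I1.
  move=> [Vw Ww] xi pw; have := congr1 (fun g => g w) E; rewrite prestrT //= pw /=.
  have := congr1 (fun g => g w) E2; rewrite prestrT //=.
  case: (q2 w) => [a|] /= -> //= [] Exi; exists a => //.
  by apply: Fcls_end; rewrite /Fcls -[RHS]Exi -{2}(repK xi).
have dN w : (V `&` W) w -> p w = None -> q2 w = None.
  move=> [Vw Ww] pw; have := congr1 (fun g => g w) E; rewrite prestrT //= pw /=.
  by have := congr1 (fun g => g w) E2; rewrite prestrT //=; case: (q2 w) => [a|] /= ->.
apply/funext => w; have [VWw|nw] := pselect ((V `&` W) w); last first.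
  by rewrite !prestrF // => -[].
rewrite (prestrT _ VWw) /=; case pw : (p w) => [xi|] /=.
  have [a qa ->] := dE w VWw xi pw.
  by rewrite prestrT /eval_along /= ?qa //; split=> //; rewrite /pdom /= qa.
by rewrite prestrF // => -[_]; rewrite /pdom /= (dN w).
Qed.

Definition tau_map : smap pointedF X := exist _ _ tau_smooth.

(* A path c^{r -> s} is in general not constant near 0 and 1, and no
   diffeomorphism of [0, 1] makes it so. Before being concatenated it is
   precomposed with a smooth phi : [0, 1] -> [0, 1] equal to 0 near 0 and to 1
   near 1. For a path that is already constant near 0 and 1, precomposition with
   a phi of positive derivative between its plateaus does not change the class
   modulo [reparam]. *)
Definition flattening := {phi : smap I I |
  [/\ cst_near_ends (sval phi), sval phi I0 = I0 & sval phi I1 = I1]}.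

Section Transport.
Variables (phi : flattening) (c : smooth_path X) (r : R) (b : Cinf) (hb : based b)
  (hr : c r = Some (sval b I1)).

Let cr : pdom c r. Proof. by rewrite /pdom /= hr. Qed.

Definition flat_seg s (hs : pdom c s) : Cinf := comp_map (seg cr hs) (sval phi).

Lemma flat_seg_ends s (hs : pdom c s) : cst_near_ends (sval (flat_seg hs)).
Proof.
have [[e e0 h] _ _] := svalP phi; exists e => // t.
by split=> [/(h t).1|/(h t).2] /= ->.
Qed.

Lemma flat_seg0 s (hs : pdom c s) : sval (flat_seg hs) I0 = sval b I1.
Proof.
have [_ p0 _] := svalP phi; rewrite /= p0; apply: oval_eq.
by rewrite I0E mul0r add0r subr0 mul1r.
Qed.

Definition flat_concat s (hs : pdom c s) : Cinf :=
  cat (flat_seg_ends hs) hb.1 (flat_seg0 hs).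

Lemma flat_concat_based s (hs : pdom c s) : based (flat_concat hs).
Proof.
split; first by apply: catf_ends; [exact: flat_seg_ends|exact: hb.1].
by rewrite /= catf0; exact: hb.2.
Qed.

Definition transport_fun (s : R) : option pointedF :=
  match pselect (pdom c s) with
  | left hs => Some (class_of_based (flat_concat_based hs))
  | right _ => None
  end.

Lemma transport_fun_dom : pdom transport_fun = pdom c.
Proof.
by apply/funext => s; apply/propext; rewrite {1}/pdom /= /transport_fun; case: pselect.
Qed.

Lemma transport_fun_itv : is_interval (pdom transport_fun).
Proof. by rewrite transport_fun_dom; exact: path_itv. Qed.

Lemma transport_fun_plot : plot (fun s : 'rV[R]_1 => transport_fun (s 0 0)).
Proof.
pose q (s : 'rV[R]_1) : option Cinf :=
  if pselect (pdom c (s 0 0)) is left hs then Some (flat_concat hs) else None.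
have dq : pdom q = pdom (fun s : 'rV[R]_1 => c (s 0 0)).
  by apply/funext => s; apply/propext; rewrite {1}/pdom /= /q; case: pselect.
have oq : open (pdom q) by rewrite dq; exact: plot_open (path_plot c).
have pq : plot q.
  split=> // m V u p oV su uV pp.
  have sphi := svalP (sval phi).
  have [[e e0 he] phi0 _] := svalP phi; have [[d d0 hd] _] := hb.
  pose B w (t : I) : X :=
    if pselect (pdom c (u w 0 0)) is left hs then sval (flat_seg hs) t else x0.
  have H : plot (prestr V (fun w => omap (catf (B w) (sval b)) (p w))).
    apply: (@plot_catf m V p B (sval b) (Num.min e d)) => //.
    - by rewrite lt_min e0.
    - exact: (svalP b).
    - move=> w t Vw; rewrite lt_min => /andP[te _]; rewrite /B.
      have : pdom c (u w 0 0) by have := uV w Vw; rewrite dq.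
      case: pselect => // hs _; rewrite -(flat_seg0 hs).
      by rewrite /= (he t).1.
    - move=> t h; apply: (hd t).2; apply: le_lt_trans h.
      by rewrite lerD2l lerN2 ge_min lexx orbT.
    - move=> q' pq'.
      have cV w : V w -> pdom c (u w 0 0) by move=> /uV; rewrite dq.
      have := seg_family_plot cr sphi oV (fun k => kdiff_coord 0 0 oV (su k)) cV pq'.
      move/plot_ext; apply.
      apply/funext => w; have [Vw|nw] := pselect (V w); last by rewrite !prestrF.
      rewrite !prestrT //; case: (q' w) => //= t; rewrite /B.
      have := cV w Vw; case: pselect => // hs _.
      by rewrite /= /seg_fun ovalE.
  apply: (plot_ext H).
  apply/funext => w; have [Vw|nw] := pselect (V w); last by rewrite !prestrF.
  rewrite !prestrT // /eval_along /q /B; have := uV w Vw; rewrite dq /pdom /=.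
  by case: pselect.
move=> /= s hs.
have pq1 : plot (omap (qcls reparam) \o q : _ -> option Cinf_sim).
  move=> s' hs'; exists setT, q; split=> //; first by split=> //; exact: openT.
  by rewrite prestr_dom.
exists setT, (omap (qcls reparam) \o q); split=> //; first by split=> //; exact: openT.
rewrite prestr_dom //; apply/funext => s'; rewrite /= /transport_fun /q.
by case: pselect.
Qed.

(* s |-> [c^{r -> s} \/ b] *)
Definition transport : smooth_path pointedF := Path transport_fun_plot (@transport_fun_itv).

End Transport.

Definition theta_start (ar : phat pointedF) : pointedF := oval (svalP ar).

Lemma theta_end (ar : phat pointedF) :
  path_map tau_map (sval ar).1 (sval ar).2 = Some (sval (rep (theta_start ar)) I1).
Proof. by rewrite /= -[(sval ar).1 _]/(((sval ar).1) (sval ar).2) -(ovalE (svalP ar)). Qed.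

Definition Theta (phi : flattening) (ar : phat pointedF) : smooth_path pointedF :=
  transport phi (rep_based (theta_start ar)) (theta_end ar).

Definition alpha_bar (phi : flattening) (alpha : smooth_path X) (t0 : R)
    (beta0 : Cinf) (hb : based beta0)
    (h : alpha t0 = Some (tau (class_of_based hb))) : smooth_path pointedF :=
  transport phi hb (etrans h (congr1 Some (tau_class hb))).

End PathSpace.

Arguments flattening R : clear implicits.
Arguments cst_near_ends {R Y} a.
Arguments tau {R X x0} xi.
Arguments Theta {R X x0} phi ar.

(* Main.v *)
(** Theta_r of a lift of alpha through [beta0] only differs from alpha_bar in the
    representative of the class [beta0] that is prolonged along alpha, so the point
    is that b |-> [c \/ b] is well defined on retrace classes and that
    [cst \/ b] = [b]; the latter makes alpha_bar itself a lift, hence horizontal.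
    Both reduce to three changes of parameter: c \/ a ~ c \/ a' if a ~ a',
    (c \/ b) \/ a ~ c \/ (b \/ a), and b ~ cst \/ b. The obvious ones are only
    piecewise smooth. As all the paths are constant near their end points, the
    breaks can be smoothed by interpolating between increasing functions with a
    smooth step, which produces a smooth F : R -> R of positive derivative fixing
    0 and 1. *)

Require Import Defs.
From mathcomp Require Import all_boot all_order all_algebra.
From mathcomp Require Import boolp classical_sets reals.
From mathcomp Require Import functions topology normedtype derive.
From mathcomp Require Import sequences realfun exp ring lra.
From Stdlib Require Import Relation_Operators.

Import Order.TTheory GRing.Theory Num.Theory numFieldNormedType.Exports.

Set Implicit Arguments.
Unset Strict Implicit.
Unset Printing Implicit Defensive.

Local Open Scope ring_scope.
Local Open Scope classical_set_scope.

(** * Smooth step functions *)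

Section Calculus.
Context {R : realType}.

(** The differential of 1/f is -(1/f)^2 df, so order k + 1 reduces to order k of 1/f itself. *)
Lemma kdiffV (V : normedModType R) k (U : set V) (f : V -> R) : open U ->
  (forall x, U x -> f x != 0) -> kdiff k U f -> kdiff k U (fun x => (f x)^-1).
Proof.
move=> oU f0; elim: k => [//|k IH kf]; have [df ddf] := kf.
have kVf := IH (kdiffS kf).
split=> [x Ux|v]; first exact: differentiableV (df _ Ux) (f0 _ Ux).
apply: kdiff_eq oU _ (kdiffM oU (@kdiff_cst R V R k U (-1))
  (kdiffM oU (kdiffM oU kVf kVf) (ddf v))) => x Ux /=.
apply: etrans (esym (congr1 (@^~ v) (diffV (df _ Ux) (f0 _ Ux)))).
change ('d (fun y => f y) x v) with ('d f x v).
by transitivity (- f x ^- 2 * 'd f x v); rewrite // mulN1r -mulNr expr2 invfM.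
Qed.

Lemma diff_scale1 (f : R -> R) (x v : R) : 'd f x v = v * 'd f x 1.
Proof. by rewrite -{1}[v]mulr1 -[v * 1]/(v *: (1 : R)) linearZ. Qed.

Lemma kdiff_compR (V : normedModType R) k (U : set V) (U' : set R)
    (f : V -> R) (g : R -> R) : open U -> open U' ->
  (forall x, U x -> U' (f x)) ->
  kdiff k U f -> kdiff k U' g -> kdiff k U (fun x => g (f x)).
Proof.
move=> oU oU' fU; elim: k f g fU => [//|k IH] f g fU kf kg.
have [df ddf] := kf; have [dg ddg] := kg.
split=> [x Ux|v]; first exact: differentiable_comp (df _ Ux) (dg _ (fU _ Ux)).
apply: kdiff_eq oU _ (kdiffM oU (ddf v) (IH _ _ fU (kdiffS kf) (ddg 1))) => x Ux /=.
apply: etrans (esym (congr1 (@^~ v) (diff_comp (df _ Ux) (dg _ (fU _ Ux))))).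
by rewrite [RHS]diff_scale1.
Qed.

Lemma is_derive_differentiable (f : R -> R) (x l : R) :
  is_derive x 1 f l -> differentiable f x /\ 'd f x 1 = l.
Proof.
move=> [df dE]; have dfx : differentiable f x by exact/derivable1_diffP.
by split=> //; rewrite -deriveE.
Qed.

Lemma differentiable_is_derive (f : R -> R) (x : R) :
  differentiable f x -> is_derive x 1 f ('d f x 1).
Proof. by move=> df; apply: DeriveDef; [exact/derivable1_diffP|rewrite deriveE]. Qed.

Lemma open_ltr (y : R) : open [set x : R | x < y].
Proof. exact: open_lt. Qed.

Lemma open_gtr (y : R) : open [set x : R | y < x].
Proof. exact: open_gt. Qed.

(** The classical e^(-1/x), extended by 0, with an extra factor x^(-n): derivatives of members of
    this family are combinations of members, so smoothness is proved for all n at once. *)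
Definition flat_exp (n : nat) (x : R) : R :=
  if 0 < x then x^-1 ^+ n * expR (- x^-1) else 0.

Lemma flat_exp_le0 n x : x <= 0 -> flat_exp n x = 0.
Proof. by rewrite /flat_exp leNgt => /negbTE ->. Qed.

Lemma flat_exp_ge0 n x : 0 <= flat_exp n x.
Proof.
rewrite /flat_exp; case: ifP => // x0.
by rewrite mulr_ge0 ?expR_ge0 // exprn_ge0 // invr_ge0 ltW.
Qed.

(** With y = 1/x this is the bound y^(n+2) / (n+2)! <= e^y. Being quadratic in x, it forces the
    derivative at 0 to vanish. *)
Lemma flat_exp_sq n x : flat_exp n x <= (n.+2)`!%:R * x ^+ 2.
Proof.
have [x0|x0] := leP x 0.
  by rewrite flat_exp_le0 // mulr_ge0 // sqr_ge0.
rewrite /flat_exp x0.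
have y0 : 0 < x^-1 by rewrite invr_gt0.
have := expR_ge1Dxn n.+1 (ltW y0); set y := x^-1 in y0 * => h.
have {}h : y ^+ n.+2 / n.+2`!%:R <= expR y by apply: le_trans h; rewrite lerDr.
have f0 : 0 < n.+2`!%:R :> R by rewrite ltr0n fact_gt0.
rewrite expRN ler_pdivrMr ?expR_gt0 //.
rewrite ler_pdivrMr // in h.
have -> : y ^+ n = y ^+ n.+2 * x ^+ 2.
  by rewrite -addn2 exprD -mulrA -exprMn mulVf ?gt_eqF // expr1n mulr1.
rewrite [leRHS]mulrAC; apply: ler_wpM2r; first exact: sqr_ge0.
by rewrite mulrC.
Qed.

Lemma is_derive_flat_exp n (x : R) :
  is_derive x 1 (flat_exp n) (flat_exp n.+2 x - n%:R * flat_exp n.+1 x).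
Proof.
have [x0|x0|x0] := ltgtP x 0.
- rewrite !flat_exp_le0 ?(ltW x0) // mulr0 subr0.
  apply: (@near_eq_is_derive _ _ _ (cst 0)).
  by near=> z; rewrite flat_exp_le0 //; apply: ltW; near: z; exact: lt_nbhsl.
- have dinv := is_deriveV (lt0r_neq0 x0) (is_derive_id x 1).
  have dM := is_deriveM (is_deriveX n dinv)
    (is_derive1_comp (is_derive_expR _) (is_deriveN dinv)).
  apply: (near_eq_is_derive _ (is_derive_eq dM _)).
    have : \forall z \near x, 0 < z by exact: lt_nbhsr.
    by apply: filterS => z z0; rewrite /flat_exp z0 !fctE.
  rewrite /flat_exp x0 !fctE /= /GRing.scale /= -exprVn.
  by case: n {dM} => [|n]; rewrite ?mul0r !exprS ?expr0; ring.
- rewrite {}x0 !flat_exp_le0 // mulr0 subr0.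
  (* At 0 the difference quotient is at most (n+2)! |h| in absolute value, by [flat_exp_sq]. *)
  have H : (fun h : R => h^-1 *: ((flat_exp n \o shift 0) (h *: 1) - flat_exp n 0))
      @ (0 : R)^' --> (0 : R).
    apply/cvgrPdist_le => /= e e0.
    have f0 : 0 < n.+2`!%:R :> R by rewrite ltr0n fact_gt0.
    have C0 : 0 < e / n.+2`!%:R by rewrite divr_gt0.
    near=> h.
    have h0 : h != 0 by near: h; exact: nbhs_dnbhs_neq.
    have hC : `|h| < e / (n.+2)`!%:R.
      by near: h; exact: dnbhs0_lt.
    rewrite sub0r normrN /= (flat_exp_le0 n (lexx 0)) subr0 addr0 [h *: 1]mulr1.
    rewrite normrM normfV (ger0_norm (flat_exp_ge0 _ _)) mulrC.
    rewrite ler_pdivrMr ?normr_gt0 //; apply: le_trans (flat_exp_sq _ _) _.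
    rewrite ltr_pdivlMr // in hC.
    by rewrite -real_normK ?num_real // expr2 mulrA ler_wpM2r // mulrC ltW.
  by apply: DeriveDef; [apply/cvg_ex; exists 0|exact/cvg_lim].
Unshelve. all: by end_near.
Qed.

Lemma flat_exp_smooth n : smooth_on setT (flat_exp n).
Proof.
move=> k; elim: k n => [//|k IH] n.
have dE x := is_derive_differentiable (is_derive_flat_exp n x).
split=> [x _|v]; first by have [] := dE x.
have := kdiffM openT (@kdiff_cst R R R k setT v) (kdiffD openT (IH n.+2)
  (kdiffM openT (@kdiff_cst R R R k setT (- n%:R)) (IH n.+1))).
apply: kdiff_eq openT _ => x _.
by have [_ E] := dE x; rewrite [RHS]diff_scale1 E mulNr.
Qed.

Lemma flat_exp_gt0 n x : 0 < x -> 0 < flat_exp n x.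
Proof.
by move=> x0; rewrite /flat_exp x0 mulr_gt0 ?expR_gt0 // exprn_gt0 // invr_gt0.
Qed.

Lemma flat_exp_nondecreasing : {homo flat_exp 0 : x y / x <= y}.
Proof.
move=> x y xy; have [x0|x0] := leP x 0.
  by rewrite flat_exp_le0 // flat_exp_ge0.
have y0 := lt_le_trans x0 xy; rewrite /flat_exp x0 y0 !expr0 !mul1r.
by rewrite ler_expR lerN2 lef_pV2.
Qed.

(** The standard transition function; the denominator never vanishes because x or 1 - x is
    positive. *)
Definition step01 (x : R) : R := flat_exp 0 x / (flat_exp 0 x + flat_exp 0 (1 - x)).

Lemma step01_den_gt0 x : 0 < flat_exp 0 x + flat_exp 0 (1 - x).
Proof.
have [x0|x0] := leP x 0.
  by rewrite ltr_wpDl ?flat_exp_ge0 // flat_exp_gt0 //; lra.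
by rewrite ltr_pwDl ?flat_exp_ge0 // flat_exp_gt0.
Qed.

Lemma step01_smooth : smooth_on setT step01.
Proof.
have sN k : kdiff k setT (fun x : R => flat_exp 0 (1 - x)).
  apply: (@kdiff_compR _ _ _ setT (fun x : R => 1 - x) (flat_exp 0)); [exact: openT|exact: openT|by []| |].
    have := kdiffD openT (@kdiff_cst R R R k setT 1)
      (kdiffM openT (@kdiff_cst R R R k setT (-1)) (@kdiff_id R R k setT)).
    by apply: kdiff_eq openT _ => x _; rewrite mulN1r.
  exact: flat_exp_smooth.
move=> k; apply: kdiffM; [exact: openT|exact: flat_exp_smooth|].
apply: kdiffV; [exact: openT|by move=> x _; rewrite lt0r_neq0 // step01_den_gt0|].
by apply: kdiffD; [exact: openT|exact: flat_exp_smooth|].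
Qed.

Lemma step01_le0 x : x <= 0 -> step01 x = 0.
Proof. by move=> x0; rewrite /step01 flat_exp_le0 // mul0r. Qed.

Lemma step01_ge1 x : 1 <= x -> step01 x = 1.
Proof.
move=> x1; have := step01_den_gt0 x; rewrite /step01 [flat_exp 0 (1 - x)]flat_exp_le0.
  by rewrite addr0 => h; rewrite divff // lt0r_neq0.
by rewrite subr_le0.
Qed.

Lemma step01_bound x : 0 <= step01 x <= 1.
Proof.
rewrite divr_ge0 ?flat_exp_ge0 ?(ltW (step01_den_gt0 _)) //=.
by rewrite ler_pdivrMr ?step01_den_gt0 // mul1r lerDl flat_exp_ge0.
Qed.

Lemma step01_nondecreasing : {homo step01 : x y / x <= y}.
Proof.
move=> x y xy; rewrite ler_pdivrMr ?step01_den_gt0 // mulrAC.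
rewrite ler_pdivlMr ?step01_den_gt0 //.
(* This is what monotonicity amounts to once denominators are cleared and the common product of the
   values at x and y is cancelled. *)
have H : flat_exp 0 x * flat_exp 0 (1 - y) <= flat_exp 0 y * flat_exp 0 (1 - x).
  by rewrite ler_pM ?flat_exp_ge0 ?flat_exp_nondecreasing //; lra.
by rewrite !mulrDr [flat_exp 0 y * flat_exp 0 x]mulrC lerD2l.
Qed.

End Calculus.

(** * Interpolation of increasing smooth functions *)

Section Incr.
Context {R : realType}.

(** [incr_derive1_ge0] concerns strictly increasing functions, so it is applied to f + e id for
    arbitrary e > 0. *)
Lemma nondecreasing_diff_ge0 (f : R -> R) (x : R) : (forall y : R, differentiable f y) ->
  {homo f : y z / y <= z} -> 0 <= 'd f x 1.
Proof.
move=> df hf; apply/ler_addgt0Pr => /= e e0.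
have dg (y : R) : is_derive y 1 (f + e *: id : R -> R) ('d f y 1 + e *: 1).
  exact: is_deriveD (differentiable_is_derive (df y)) _.
have := @incr_derive1_ge0 R (f + e *: id : R -> R) setT x.
rewrite derive1E derive_val [e *: 1]mulr1; apply.
- by move=> y _; have [] := dg y.
- move=> y z _ _ yz; rewrite !fctE; apply: ler_ltD; first exact: hf (ltW yz).
  by rewrite ltr_pM2l.
- by rewrite interiorT.
Qed.

Lemma kdiff_affine (V : normedModType R) k (U : set V) (f : V -> R) (a b : R) : open U ->
  kdiff k U f -> kdiff k U (fun x => a * f x + b).
Proof.
move=> oU kf; apply: kdiffD => //; last exact: kdiff_cst.
by apply: kdiffM => //; exact: kdiff_cst.
Qed.

Lemma smooth_step (u v : R) : u < v -> exists chi : R -> R,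
  [/\ smooth_on setT chi, forall x, 0 <= chi x <= 1 /\ 0 <= 'd chi x 1,
      forall x, x <= u -> chi x = 0 & forall x, v <= x -> chi x = 1].
Proof.
move=> uv; have w0 : 0 < (v - u)^-1 by rewrite invr_gt0 subr_gt0.
exists (fun x => step01 ((v - u)^-1 * x + - (u / (v - u)))).
have sc : smooth_on setT (fun x => step01 ((v - u)^-1 * x + - (u / (v - u)))).
  move=> k; apply: (@kdiff_compR _ _ _ _ setT _ step01);
    [exact: openT|exact: openT|by []| |exact: step01_smooth].
  apply: (@kdiff_affine _ _ _ idfun); [exact: openT|exact: kdiff_id].
have E x : (v - u)^-1 * x + - (u / (v - u)) = (x - u) / (v - u) by ring.
split=> //.
- move=> x; split; first exact: step01_bound.
  apply: nondecreasing_diff_ge0; first by move=> y; have [d _] := sc 1%N; exact: d.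
  by move=> y z yz; apply: step01_nondecreasing; rewrite lerD2r ler_pM2l.
- by move=> x xu; rewrite E step01_le0 // pmulr_lle0 // subr_le0.
- move=> x vx; rewrite E step01_ge1 // ler_pdivlMr ?subr_gt0 //; lra.
Qed.

(** A positive derivative, and not just strict monotonicity, makes the inverse smooth as well. *)
Definition smooth_incr (U : set R) (f : R -> R) :=
  smooth_on U f /\ forall x, U x -> 0 < 'd f x 1.

Lemma smooth_incr_eq (U : set R) (f g : R -> R) : open U ->
  (forall x, U x -> f x = g x) -> smooth_incr U f -> smooth_incr U g.
Proof.
move=> oU fg [sf pf]; split=> [k|x Ux]; first exact: kdiff_eq oU fg (sf k).
have [d _] := sf 1%N; have [_ ->] := near_eq_diff
  (filterS fg (open_nbhs_nbhs (conj oU Ux))) (d x Ux).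
exact: pf.
Qed.

Lemma smooth_incr_sub (U U' : set R) (f : R -> R) :
  U' `<=` U -> smooth_incr U f -> smooth_incr U' f.
Proof.
move=> UU' [sf pf]; split=> [k|x /UU']; last exact: pf.
exact: kdiff_sub UU' (sf k).
Qed.

Lemma smooth_incr_loc (U : set R) (f : R -> R) :
  (forall x, U x -> exists2 A, open_nbhs x A & smooth_incr (A `&` U) f) ->
  smooth_incr U f.
Proof.
move=> H; split=> [k|x Ux].
  by apply: kdiff_loc => x /H[A oA [sA _]]; exists A.
by have [A [_ Ax] [_ ->]] := H x Ux.
Qed.

Lemma smooth_incr_affine (a b : R) : 0 < a -> smooth_incr setT (fun x => a * x + b).
Proof.
move=> a0; split=> [k|x _].
  by apply: (@kdiff_affine _ _ _ idfun); [exact: openT|exact: kdiff_id].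
have : is_derive x 1 (a *: id + cst b : R -> R) (a *: 1 + 0) by exact: is_deriveD.
by move=> /is_derive_differentiable[_]; rewrite [a *: 1]mulr1 addr0 => ->.
Qed.

Lemma smooth_incr_comp (U U' : set R) (f g : R -> R) : open U -> open U' ->
  (forall x, U x -> U' (f x)) -> smooth_incr U f -> smooth_incr U' g ->
  smooth_incr U (fun x => g (f x)).
Proof.
move=> oU oU' UU' [sf pf] [sg pg]; split=> [k|x Ux].
  exact: (kdiff_compR oU oU' UU' (sf k) (sg k)).
have [_ E] := is_derive_differentiable (is_derive1_comp
  (differentiable_is_derive ((sg 1%N).1 _ (UU' _ Ux)))
  (differentiable_is_derive ((sf 1%N).1 _ Ux))).
rewrite (E : 'd (fun x => g (f x)) x 1 = _).
by apply: mulr_gt0; [exact: pg (UU' _ Ux)|exact: pf Ux].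
Qed.

Lemma blend_deriv_gt0 (c a b da db dc : R) : 0 <= c <= 1 -> 0 < da -> 0 < db ->
  0 <= dc -> a <= b -> 0 < da + (c * (db - da) + (b - a) * dc).
Proof.
move=> /andP[c0 c1] a0 b0 dc0 ab.
have H1 : 0 <= (b - a) * dc by rewrite mulr_ge0 // subr_ge0.
have [->|c_neq0] := eqVneq c 0; first lra.
have H2 : 0 < c * db by rewrite mulr_gt0 // lt_neqAle eq_sym c_neq0.
have H3 : 0 <= (1 - c) * da by rewrite mulr_ge0 ?subr_ge0 // ltW.
lra.
Qed.

(* The derivative of f1 + chi (f2 - f1) is a convex combination of those of f1
   and f2 plus the term chi' (f2 - f1), nonnegative since f1 <= f2 where chi varies. *)
Lemma smooth_incr_blend (U : set R) (a b : R) (f1 f2 : R -> R) : open U -> a < b ->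
  smooth_incr (U `&` [set x | x < b]) f1 -> smooth_incr (U `&` [set x | a < x]) f2 ->
  (forall x, U x -> a < x < b -> f1 x <= f2 x) ->
  exists F, [/\ smooth_incr U F, forall x, x <= a -> F x = f1 x &
    forall x, b <= x -> F x = f2 x].
Proof.
(* [chi] varies only on the middle third [u, v]. Thus U is covered by x < u, where F = f1, by x > v,
   where F = f2, and by the strip a < x < b, where f1 and f2 are both smooth. *)
move=> oU ab g1 g2 f12; pose u := a + (b - a) / 3; pose v := a + (b - a) * 2 / 3.
have [au uv vb] : [/\ a < u, u < v & v < b] by rewrite /u /v; split; lra.
have [chi [schi bchi chi0 chi1]] := smooth_step uv.
pose F x := f1 x + chi x * (f2 x - f1 x); exists F.
have F1 x : x <= u -> F x = f1 x by move=> xu; rewrite /F chi0 // mul0r addr0.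
have F2 x : v <= x -> F x = f2 x by move=> xu; rewrite /F chi1 // mul1r addrC subrK.
split; last 2 first.
- by move=> x xa; apply: F1; lra.
- by move=> x xa; apply: F2; lra.
have [s1 p1] := g1; have [s2 p2] := g2.
apply: smooth_incr_loc => x Ux; have [xu|ux] := ltP x u.
  exists [set x | x < u]; first by split=> //; exact: open_ltr.
  apply: (@smooth_incr_eq _ f1); first by apply: openI => //; exact: open_ltr.
    by move=> y [/= yu _]; rewrite F1 // ltW.
  by apply: smooth_incr_sub g1 => y [/= yu Uy]; split=> //=; lra.
have [vx|xv] := ltP v x.
  exists [set x | v < x]; first by split=> //; exact: open_gtr.
  apply: (@smooth_incr_eq _ f2); first by apply: openI => //; exact: open_gtr.
    by move=> y [/= yu _]; rewrite F2 // ltW.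
  by apply: smooth_incr_sub g2 => y [/= yu Uy]; split=> //=; lra.
pose A := [set x | a < x] `&` [set x : R | x < b].
have oA : open A by apply: openI; [exact: open_gtr|exact: open_ltr].
exists A; first by split=> //; split=> /=; lra.
have oAU := openI oA oU.
have t1 k : kdiff k (A `&` U) f1 by apply: kdiff_sub (s1 k) => y [[_ ?] ?].
have t2 k : kdiff k (A `&` U) f2 by apply: kdiff_sub (s2 k) => y [[? _] ?].
have tc k : kdiff k (A `&` U) chi by apply: kdiff_sub (schi k).
split=> [k|y AUy].
  apply: kdiffD => //; apply: kdiffM => //; apply: kdiffD => //.
  have := kdiffM oAU (@kdiff_cst R R R k (A `&` U) (-1)) (t1 k).
  by apply: kdiff_eq => // z _; rewrite mulN1r.
have i1 := differentiable_is_derive ((t1 1%N).1 y AUy).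
have i2 := differentiable_is_derive ((t2 1%N).1 y AUy).
have ic := differentiable_is_derive ((tc 1%N).1 y AUy).
have [_] := is_derive_differentiable (is_deriveD i1 (is_deriveM ic (is_deriveB i2 i1))).
move=> E; rewrite [X in 0 < X]E.
have [[/= ay yb] Uy] := AUy.
have [c01 dc0] := bchi y.
have ff : f1 y <= f2 y by apply: f12; rewrite ?ay.
exact: (blend_deriv_gt0 c01 (p1 y (conj Uy yb)) (p2 y (conj Uy ay)) dc0 ff).
Qed.

(** Two blends through the straight line L from (x1, c1) to (x2, c2): f1 <= c1 <= L on the first
    overlap and L <= c2 <= f2 on the second, so f1 and f2 need not be compared directly. *)
Lemma smooth_incr_interp (U : set R) (x1 y1 y2 x2 c1 c2 : R) (f1 f2 : R -> R) :
  open U -> x1 < y1 -> y1 <= y2 -> y2 < x2 -> c1 < c2 ->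
  smooth_incr (U `&` [set x | x < y1]) f1 ->
  smooth_incr (U `&` [set x | y2 < x]) f2 ->
  (forall x, U x -> x1 < x < y1 -> f1 x <= c1) ->
  (forall x, U x -> y2 < x < x2 -> c2 <= f2 x) ->
  exists F, [/\ smooth_incr U F, forall x, x <= x1 -> F x = f1 x &
    forall x, x2 <= x -> F x = f2 x].
Proof.
move=> oU xy1 y12 yx2 c12 g1 g2 b1 b2.
pose s := (c2 - c1) / (x2 - x1).
have s0 : 0 < s by rewrite divr_gt0 ?subr_gt0 //; lra.
pose L x := s * x + (c1 - s * x1).
have gL := @smooth_incr_affine s (c1 - s * x1) s0.
have L1 x : x1 <= x -> c1 <= L x.
  by move=> h; have : 0 <= s * (x - x1); [rewrite mulr_ge0 ?subr_ge0 // ltW|rewrite /L; lra].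
have L2 x : x <= x2 -> L x <= c2.
  move=> h; have : 0 <= s * (x2 - x) by rewrite mulr_ge0 ?subr_ge0 // ltW.
  have : s * (x2 - x1) = c2 - c1 by rewrite divfK // subr_eq0 gt_eqF //; lra.
  rewrite /L; lra.
have [G [gG G1 G2]] : exists G, [/\ smooth_incr U G, forall x, x <= x1 -> G x = f1 x &
    forall x, y1 <= x -> G x = L x].
  apply: smooth_incr_blend => //.
    by apply: smooth_incr_sub gL.
  move=> x Ux h; apply: le_trans (b1 x Ux h) (L1 x _); lra.
have [F [gF F1 F2]] : exists F, [/\ smooth_incr U F, forall x, x <= y2 -> F x = G x &
    forall x, x2 <= x -> F x = f2 x].
  apply: smooth_incr_blend => //.
    by apply: smooth_incr_sub gG => x [].
  move=> x Ux h; apply: le_trans (b2 x Ux h); rewrite G2; last lra.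
  by apply: L2; lra.
exists F; split=> // x h; rewrite F1 ?G1 //; lra.
Qed.

End Incr.

(** * Diffeomorphisms of the unit interval *)

Section Inverse.
Context {R : realType}.

Lemma smooth_on_continuous (F : R -> R) : smooth_on setT F -> continuous F.
Proof. by move=> sF x; exact: (smooth_continuous sF). Qed.

Lemma smooth_incr_lt (F : R -> R) : smooth_incr setT F -> {homo F : x y / x < y}.
Proof.
move=> [sF pF] x y xy; have dF z := differentiable_is_derive ((sF 1%N).1 z I).
apply: (@gtr0_derive1_lt_cc R F x y) => //; rewrite ?in_itv /= ?lexx ?(ltW xy) //.
- by move=> z _; rewrite derive1E; have [_ ->] := dF z; exact: pF.
- exact/continuous_subspaceT/smooth_on_continuous.
Qed.

Lemma smooth_incr_le (F : R -> R) : smooth_incr setT F -> {mono F : x y / x <= y}.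
Proof. by move=> gF; apply: le_mono; exact: smooth_incr_lt. Qed.

Lemma smooth_incr_range_itv (F : R -> R) (x y z : R) : smooth_incr setT F -> x <= y ->
  F x <= z <= F y -> exists2 c, x <= c <= y & F c = z.
Proof.
move=> gF xy h; have cF := smooth_on_continuous gF.1.
have [] := @IVT R F x y z xy (continuous_subspaceT cF).
  have Fxy : F x <= F y by rewrite (smooth_incr_le gF).
  by rewrite min_l // max_r.
by move=> c; rewrite in_itv => h' <-; exists c.
Qed.

(** F x lies in the open interval from F (x - 1) to F (x + 1), which is inside the range by the
    intermediate value theorem. *)
Lemma smooth_incr_open_range (F : R -> R) : smooth_incr setT F -> open (range F).
Proof.
move=> gF; have lF := smooth_incr_lt gF; rewrite openE => _ [x _ <-].
have oA : open ([set z | F (x - 1) < z] `&` [set z | z < F (x + 1)]).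
  by apply: openI; [exact: open_gtr|exact: open_ltr].
have Ax : ([set z | F (x - 1) < z] `&` [set z | z < F (x + 1)]) (F x).
  by split=> /=; apply: lF; lra.
apply: filterS (open_nbhs_nbhs (conj oA Ax)) => z [/= h1 h2].
have [||c _ <-] := @smooth_incr_range_itv F (x - 1) (x + 1) z gF; [lra| |by exists c].
by rewrite !ltW.
Qed.

(** The inverse G has derivative 1 / (F' o G), so order k of G yields order k + 1. As F need not be
    onto, smoothness is confined to [range F]. *)
Lemma smooth_incr_inverse (F : R -> R) : smooth_incr setT F ->
  exists2 G : R -> R, cancel F G & smooth_on (range F) G.
Proof.
move=> gF; have FI : injective F by exact: inc_inj (smooth_incr_le gF).
(* The default value 0 is taken outside [range F]. *)
pose G y := xget 0 [set x | F x = y].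
have FK : cancel F G.
  move=> x; apply: FI; exact: (@xgetPex _ 0 [set z | F z = F x]) (ex_intro _ x erefl).
exists G => //; have oF := smooth_incr_open_range gF.
have [sF pF] := gF; have cF := smooth_on_continuous sF.
have dG x : is_derive (F x) 1 G ('d F x 1)^-1.
  apply: (@is_derive_inverse R F G).
  - by near=> z; exact: FK.
  - by near=> z; exact: cF.
  - exact: differentiable_is_derive ((sF 1%N).1 x I).
  - by rewrite gt_eqF // pF.
elim=> [//|k IH]; split.
  by move=> _ [x _ <-]; have [] := is_derive_differentiable (dG x).
move=> v; have kG : kdiff k (range F) (fun y => ('d F (G y) 1)^-1).
  apply: kdiffV => //; first by move=> y _; rewrite gt_eqF // pF.
  apply: (@kdiff_compR _ _ _ _ setT G (fun x => 'd F x 1)) => //; first exact: openT.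
  exact: (sF k.+1).2.
have := kdiffM oF (@kdiff_cst R R R k (range F) v) kG.
apply: kdiff_eq oF _ => _ [x _ <-]; rewrite FK.
have [_ E] := is_derive_differentiable (dG x).
by apply: etrans (esym (diff_scale1 G (F x) v)); congr (_ * _); exact: esym E.
Unshelve. all: by end_near.
Qed.

Let I := @unitI R.

Lemma smooth_clamp (U : set R) (h : R -> R) : open U -> smooth_on U h ->
  (forall x, 0 <= x <= 1 -> U x /\ 0 <= h x <= 1) ->
  smooth_map (fun t : I => clamp (h (Ival t))).
Proof.
move=> oU sh hU n q pq; have oq := plot_open pq; have sq := qval_smooth pq.
have qb w : pdom q w -> 0 <= qval q w <= 1.
  by rewrite /pdom /qval /=; case: (q w) => // t _; exact: Ival_bound.
have := @unitI_plot R n (pdom q) (fun w => h (qval q w)) oq.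
move=> /(_ _ (fun w wq => (hU _ (qb w wq)).2))/plot_ext; apply.
  move=> k; apply: (@kdiff_compR _ _ _ _ U (qval q) h) => //.
  by move=> w wq; exact: (hU _ (qb w wq)).1.
apply/funext => w; rewrite /prestr /qval /pdom /=.
by case: (q w) => [t|] /=; [rewrite asboolT|rewrite asboolF].
Qed.

(** Constant on either side of [0, 1], hence possibly not differentiable at 0 and 1 even for smooth
    f. *)
Definition real_ext (f : I -> I) (x : R) : R := Ival (f (clamp x)).

(** Smoothness of f is known only along plots: s becomes a plot of [unitI] on row vectors of length
    1, and the result is pulled back along x |-> [x *: const_mx 1]. *)
Lemma real_ext_smooth (f : I -> I) (U : set R) (s : R -> R) : smooth_map f -> open U ->
  smooth_on U s -> (forall x, U x -> 0 <= s x <= 1) ->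
  smooth_on U (fun x => real_ext f (s x)).
Proof.
move=> sf oU ss sU.
pose W := [set r : 'rV[R]_1 | U (r 0 0)].
have sc : smooth_on setT (fun r : 'rV[R]_1 => r 0 0).
  by move=> k; apply: (@kdiff_coord _ _ _ _ _ _ idfun); [exact: openT|exact: kdiff_id].
have oW : open W.
  by have := open_preim_smooth openT sc oU; rewrite setTI.
have pW : plot (prestr W (fun r : 'rV[R]_1 => Some (clamp (s (r 0 0))))).
  apply: unitI_plot => //; last by move=> w; exact: sU.
  move=> k; apply: (@kdiff_compR _ _ _ _ U (fun r : 'rV[R]_1 => r 0 0) s) => //.
  by apply: kdiff_sub (sc k).
have [_ sW] := sf _ _ pW.
move=> k; have kW : kdiff k W (fun r : 'rV[R]_1 => real_ext f (s (r 0 0))).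
  have := sW k; rewrite !pdom_omap pdom_restr.
  have -> : W `&` pdom (fun r : 'rV[R]_1 => Some (clamp (s (r 0 0)))) = W.
    by apply/seteqP; split=> [r []|r].
  by apply: kdiff_eq oW _ => r Wr; rewrite /= prestrT.
have E (x : R) : (x *: const_mx 1 : 'rV[R]_1) 0 0 = x by rewrite !mxE mulr1.
have := @kdiff_comp_real R R 1 k U W (fun x : R => x *: const_mx 1)
  (fun r => real_ext f (s (r 0 0))) oU oW.
move=> /(_ _ _ kW) H; apply: (kdiff_eq oU _ (H _ _)).
- by move=> x _; rewrite E.
- by move=> x Ux; rewrite /W /= E.
- by apply: (@kdiff_scalel _ _ _ _ _ idfun) => //; exact: kdiff_id.
Qed.

Definition unit_diffeo (f g : smap I I) :=
  [/\ cancel (sval f) (sval g), cancel (sval g) (sval f), sval f I0 = I0 & sval f I1 = I1].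

(** F maps [0, 1] onto itself by monotonicity and the intermediate value theorem, so F and its
    smooth inverse both restrict. *)
Lemma smooth_incr_unit_diffeo (F : R -> R) : smooth_incr setT F -> F 0 = 0 -> F 1 = 1 ->
  exists f g : smap I I, unit_diffeo f g /\ forall t, Ival (sval f t) = F (Ival t).
Proof.
move=> gF F0 F1; have [G FK sG] := smooth_incr_inverse gF.
have mF := smooth_incr_le gF.
have Fb x : 0 <= x <= 1 -> 0 <= F x <= 1 by rewrite -{2}F0 -{2}F1 !mF.
have Gx x : 0 <= x <= 1 -> exists2 c, 0 <= c <= 1 & F c = x.
  by move=> h; apply: smooth_incr_range_itv => //; rewrite F0 F1.
have sf : smooth_map (fun t : I => clamp (F (Ival t))).
  by apply: (smooth_clamp openT gF.1) => x /Fb.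
have sg : smooth_map (fun t : I => clamp (G (Ival t))).
  apply: (smooth_clamp (smooth_incr_open_range gF) sG) => x /Gx[c h <-].
  by split; [exists c|rewrite FK].
exists (exist _ _ sf), (exist _ _ sg).
have fE t : Ival (clamp (F (Ival t))) = F (Ival t) by rewrite clampK // Fb // Ival_bound.
split; last by [].
split.
- move=> t; change (clamp (G (Ival (clamp (F (Ival t))))) = t).
  by rewrite fE FK IvalK.
- move=> t; change (clamp (F (Ival (clamp (G (Ival t))))) = t).
  by have [c h e] := Gx _ (Ival_bound t); rewrite -e FK clampK // e IvalK.
- by change (clamp (F (Ival I0)) = I0); apply: Ival_inj; rewrite fE I0E.
- by change (clamp (F (Ival I1)) = I1); apply: Ival_inj; rewrite fE I1E.
Qed.

(** The upper bound comes from 1 - s^2 (3 - 2 s) = (1 - s)^2 (1 + 2 s). The range of s is an open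
    neighbourhood of [0, 1]. *)
Lemma smoothstep_bound (s : R) : -(1/2) < s < 3/2 -> 0 <= s ^+ 2 * (3 - 2 * s) <= 1.
Proof.
move=> h; apply/andP; split; first by rewrite mulr_ge0 ?sqr_ge0 //; lra.
rewrite -subr_ge0 (_ : _ - _ = (1 - s) ^+ 2 * (1 + 2 * s)); last ring.
by rewrite mulr_ge0 ?sqr_ge0 //; lra.
Qed.

(* Composing with the cubic s^2 (3 - 2 s), which maps a neighbourhood of [0, 1]
   into [0, 1], gives access to the continuity of f at the end points. *)
Lemma unit_diffeo_mono (f g : smap I I) : unit_diffeo f g ->
  {in `[0, 1]%R &, {mono real_ext (sval f) : x y / x <= y}}.
Proof.
move=> [fK gK f0 f1].
pose U := [set s : R | -(1/2) < s] `&` [set s | s < 3/2].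
have oU : open U by apply: openI; [exact: open_gtr|exact: open_ltr].
pose s (x : R) := x * x * (-2 * x + 3).
have sE x : s x = x ^+ 2 * (3 - 2 * x) by rewrite /s; ring.
have ss : smooth_on setT s.
  move=> k; apply: kdiffM; [exact: openT| |].
    by apply: kdiffM; [exact: openT|exact: kdiff_id..].
  by apply: (@kdiff_affine _ _ _ _ idfun); [exact: openT|exact: kdiff_id].
have sb x : U x -> 0 <= s x <= 1.
  by move=> [h1 h2]; rewrite sE; apply: smoothstep_bound; rewrite h1 h2.
have UI x : 0 <= x <= 1 -> U x by move=> h; split=> /=; lra.
have smono : {in `[0, 1]%R &, {homo s : x y / x < y}}.
  move=> x y; rewrite !in_itv /= => hx hy xy; rewrite /s -subr_gt0.
  have -> : y * y * (-2 * y + 3) - x * x * (-2 * x + 3) =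
    (y - x) * (3 * (x * (1 - x) + y * (1 - y)) + (y - x) ^+ 2) by ring.
  rewrite mulr_gt0 ?subr_gt0 // ltr_wpDl //; last by rewrite exprn_gt0 // subr_gt0.
  by rewrite mulr_ge0 // addr_ge0 // mulr_ge0 //; lra.
have smono' := le_mono_in smono.
have sS x : 0 <= x <= 1 -> exists2 c, c \in `[0, 1]%R%R & s c = x.
  move=> h; apply: IVT => //; first exact/continuous_subspaceT/smooth_on_continuous.
  by rewrite /s !mul0r !mul1r mulr1 min_l ?max_r //; lra.
have sh := real_ext_smooth (svalP f) oU (fun k => kdiff_sub (@subsetT _ U) (ss k)) sb.
(* On [0, 1], f o s is continuous and injective, with values 0 at 0 and 1 at 1, hence increasing.
   Since s is increasing and onto [0, 1], so is f. *)
have Hmono : {in `[0, 1]%R &, {mono (fun x => real_ext (sval f) (s x)) : x y / x <= y}}.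
  apply: segment_continuous_inj_le.
  - have -> : s 0 = 0 by rewrite /s !mul0r.
    have -> : s 1 = 1 by rewrite /s; ring.
    by rewrite /real_ext -/I0 -/I1 f0 f1 I0E I1E.
  - apply: continuous_in_subspaceT => x /set_mem /=; rewrite in_itv /= => /UI Ux.
    exact: smooth_continuous sh Ux.
  - move=> x y hx hy; move: (hx) (hy); rewrite !in_itv /= => /UI/sb bx /UI/sb bY.
    move=> /Ival_inj/(can_inj fK)/(congr1 Ival).
    by rewrite !clampK // => e; apply/eqP; rewrite eq_le -(smono' x y) // -(smono' y x) // e lexx.
move=> x y; rewrite !in_itv /= => /sS[c hc <-] /sS[d hd <-].
by rewrite Hmono // smono'.
Qed.

Lemma factor1_gt0 (a b : R) : a * b = 1 -> 0 <= b -> 0 < b.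
Proof. by move=> ab; rewrite le0r => /predU1P[b0|//]; move: ab; rewrite b0; lra. Qed.

(** Monotonicity makes the derivative nonnegative, and the chain rule for g o f = id makes it
    nonzero. *)
Lemma unit_diffeo_smooth_incr (f g : smap I I) : unit_diffeo f g ->
  smooth_incr ([set x | 0 < x] `&` [set x | x < 1]) (real_ext (sval f)).
Proof.
move=> fg; have [fK gK f0 f1] := fg.
set U := (X in smooth_incr X).
have oU : open U by apply: openI; [exact: open_gtr|exact: open_ltr].
have sm h : smooth_map h -> smooth_on U (real_ext h).
  move=> sh; apply: (@real_ext_smooth h U idfun) => //.
    by move=> k; exact: kdiff_id.
  by move=> x [/= ? ?]; rewrite !ltW.
have UI x : U x -> x \in `[0, 1]%R by move=> [/= ? ?]; rewrite in_itv /= !ltW.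
have fm := unit_diffeo_mono fg; have fm' := leW_mono_in fm.
have E0 : real_ext (sval f) 0 = 0 by rewrite /real_ext -/I0 f0 I0E.
have E1 : real_ext (sval f) 1 = 1 by rewrite /real_ext -/I1 f1 I1E.
have fb x : U x -> U (real_ext (sval f) x).
  move=> Ux; have [/= x0 x1] := Ux; split=> /=.
    by have := fm' 0 x; rewrite E0 => -> //; [rewrite in_itv /= lexx ler01|exact: UI].
  by have := fm' x 1; rewrite E1 => -> //; [exact: UI|rewrite in_itv /= lexx ler01].
have sF := sm _ (svalP f); have sG := sm _ (svalP g).
split=> // x Ux.
have dF : differentiable (real_ext (sval f)) x by exact: (sF 1%N).1.
have dG : differentiable (real_ext (sval g)) (real_ext (sval f) x) by apply: (sG 1%N).1; exact: fb.
have iF := differentiable_is_derive dF; have iG := differentiable_is_derive dG.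
have := is_derive1_comp iG iF => iGF.
have iid : is_derive x 1 (real_ext (sval g) \o real_ext (sval f)) 1.
  apply: (@near_eq_is_derive _ _ _ id).
  apply: filterS (open_nbhs_nbhs (conj oU Ux)) => y Uy /=.
  by rewrite /real_ext IvalK fK clampK //; have := UI y Uy; rewrite in_itv.
have E : 'd (real_ext (sval g)) (real_ext (sval f) x) 1 * 'd (real_ext (sval f)) x 1 = 1.
  by have [_ <-] := iGF; have [_ ->] := iid.
apply: (factor1_gt0 E).
have := @incr_derive1_ge0_itv R (real_ext (sval f)) true false 0 1 x.
rewrite derive1E; have [_ ->] := iF; apply.
- move=> y /set_mem /=; rewrite in_itv /= => /andP[y0 y1].
  by have [] := differentiable_is_derive ((sF 1%N).1 y (conj y0 y1)).
- by move=> y z hy hz; rewrite fm'.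
- by have [/= ? ?] := Ux; rewrite in_itv /=; apply/andP.
Qed.

End Inverse.

(** * Changes of parameter of concatenations *)

Section Reparam.
Context {R : realType}.
Variable X : diffSpace R.
Let I := @unitI R.

Lemma clamp_le0 (x : R) : x <= 0 -> clamp x = I0.
Proof.
move=> x0; apply: Ival_inj; rewrite I0E /Ival /=.
by rewrite min_l ?max_l //; lra.
Qed.

Lemma clamp_ge1 (x : R) : 1 <= x -> clamp x = I1.
Proof.
move=> x1; apply: Ival_inj; rewrite I1E /Ival /=.
by rewrite min_r ?max_r //; lra.
Qed.

(** Valid for every real x: outside [0, 1] the clamped arguments sit at the matching end point. *)
Lemma catfE (b a : I -> X) (x : R) :
  catf b a (clamp x) = if x < 2^-1 then a (clamp (2 * x)) else b (clamp (2 * x - 1)).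
Proof.
have [x0|x0] := ltP x 0.
  rewrite clamp_le0 ?ltW // catf0 ifT; last lra.
  by rewrite clamp_le0 //; lra.
have [x1|x1] := ltP 1 x; last by rewrite /catf clampK // x0.
rewrite clamp_ge1 ?ltW // catf1 ifF; last by apply/negbTE; rewrite -leNgt; lra.
by rewrite clamp_ge1 //; lra.
Qed.

Lemma catf_lt (b a : I -> X) (x : R) : x < 2^-1 -> catf b a (clamp x) = a (clamp (2 * x)).
Proof. by rewrite catfE => ->. Qed.

Lemma catf_ge (b a : I -> X) (x : R) : 2^-1 <= x -> catf b a (clamp x) = b (clamp (2 * x - 1)).
Proof. by rewrite catfE ltNge => ->. Qed.

(** A form of [cst_near_ends] in which x is any real number and e is explicit, so that several paths
    can share one e. *)
Definition flat_ends (e : R) (a : I -> X) := forall x : R,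
  (x < e -> a (clamp x) = a I0) /\ (1 - e < x -> a (clamp x) = a I1).

Lemma flat_ends_exists (a : I -> X) : cst_near_ends a ->
  exists2 e0 : R, 0 < e0 & forall e, e <= e0 -> flat_ends e a.
Proof.
move=> [e0 e0_gt0 h]; exists e0 => // e ee x; split=> hx.
  have [x0|x0] := leP x 0; first by rewrite clamp_le0.
  have [x1|x1] := leP 1 x; last by apply: (h _).1; rewrite clampK; lra.
  (* Having 1 <= x < e forces e0 > 1, and then the plateau at 0 reaches the point 1. *)
  by rewrite clamp_ge1 //; apply: (h _).1; rewrite I1E; lra.
have [x1|x1] := leP 1 x; first by rewrite clamp_ge1.
have [x0|x0] := leP x 0; last by apply: (h _).2; rewrite clampK; lra.
by rewrite clamp_le0 //; apply: (h _).2; rewrite I0E; lra.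
Qed.

Lemma catf_plateau (b a : I -> X) (e x : R) : flat_ends e b -> flat_ends e a ->
  b I0 = a I1 -> (1 - e) / 2 < x < (1 + e) / 2 -> catf b a (clamp x) = a I1.
Proof.
move=> fb fa ba h; rewrite catfE; case: ltP => hx; first by apply: (fa _).2; lra.
by rewrite -ba; apply: (fb _).1; lra.
Qed.

Lemma reparam_sym (a b : Cinf X) : reparam a b -> reparam b a.
Proof.
move=> [f [g [fK gK f0 f1 E]]]; exists g, f; split=> //.
- by rewrite -[in LHS]f0 fK.
- by rewrite -[in LHS]f1 fK.
- by rewrite E; apply/funext => t /=; rewrite gK.
Qed.

Lemma reparam_trans (a b c : Cinf X) : reparam a b -> reparam b c -> reparam a c.
Proof.
move=> [f [g [fK gK f0 f1 E]]] [f' [g' [fK' gK' f0' f1' E']]].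
exists (comp_map f' f), (comp_map g g'); split=> /=.
- by move=> t /=; rewrite fK' fK.
- by move=> t /=; rewrite gK gK'.
- by rewrite f0 f0'.
- by rewrite f1 f1'.
- by rewrite E E'.
Qed.

Lemma qcls_reparam (a b : Cinf X) : reparam a b -> qcls (@reparam R X) a = qcls (@reparam R X) b.
Proof.
move=> ab; apply: eq_exist; apply/funext => c; apply/propext; split.
  exact: reparam_trans (reparam_sym ab).
exact: reparam_trans ab.
Qed.

Lemma smooth_incr_reparam (F : R -> R) (u v : Cinf X) :
  smooth_incr setT F -> F 0 = 0 -> F 1 = 1 ->
  (forall x, 0 <= x <= 1 -> sval u (clamp x) = sval v (clamp (F x))) -> reparam u v.
Proof.
move=> gF F0 F1 uv; have [f [g [[fK gK f0 f1] fE]]] := smooth_incr_unit_diffeo gF F0 F1.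
exists f, g; split=> //; apply/funext => t /=.
by rewrite -[X in sval v X]IvalK fE -uv ?IvalK // Ival_bound.
Qed.

Lemma smooth_incr_id (U : set R) : smooth_incr U (fun x => x).
Proof.
apply: smooth_incr_sub (@subsetT _ U) _.
apply: smooth_incr_eq openT _ (@smooth_incr_affine R 1 0 ltr01) => x _.
by rewrite mul1r addr0.
Qed.

(** The exact change of parameter x/2 is kept up to 1 - e, then bent so as to reach 1 at 1. There b
    is already constant, and so is v beyond (1 - e)/2. *)
Lemma reparam_cst_cat (g b v : Cinf X) : cst_near_ends (sval b) ->
  (forall t, sval g t = sval b I1) -> sval v = catf (sval g) (sval b) -> reparam b v.
Proof.
move=> /flat_ends_exists[e0 e0_gt0 fb] gE vE.
pose e := Num.min e0 2^-1; have e_gt0 : 0 < e by rewrite lt_min e0_gt0; lra.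
have e_le : e <= 2^-1 by rewrite ge_min lexx orbT.
have {}fb : flat_ends e (sval b) by apply: fb; rewrite ge_min lexx.
have [F [gF F1 F2]] : exists F : R -> R, [/\ smooth_incr setT F,
    forall x, x <= 1 - e -> F x = 2^-1 * x + 0 & forall x, 1 <= x -> F x = x].
  (* Before the midpoint of [1 - e, 1] one has x/2 <= 1/2; after it, x >= 1 - e/2 > 1/2. *)
  apply: (@smooth_incr_interp R setT _ (1 - e / 2) (1 - e / 2) _ 2^-1 (1 - e / 2));
    [exact: openT|lra|lra|lra|lra| |exact: smooth_incr_id|by move=> *; lra..].
  by apply: smooth_incr_sub (@smooth_incr_affine R 2^-1 0 _); [|lra].
have mF := smooth_incr_le gF; have ltF := leW_mono mF.
apply: (smooth_incr_reparam gF); [by rewrite F1 ?mulr0 ?addr0 //; lra|exact: F2|].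
move=> x x01; rewrite vE; have [xe|xe] := leP x (1 - e).
  rewrite F1 // catf_lt; last lra.
  by congr (sval b (clamp _)); lra.
rewrite (fb x).2 //.
have hF : (1 - e) / 2 < F x by move: xe; rewrite -ltF (F1 (1 - e)) //; lra.
by rewrite catfE; case: ltP => h; [rewrite (fb _).2 //; lra|rewrite gE].
Qed.

(** The piecewise affine change of parameter has slopes 1/2, 1, 2 with breaks at 1/2 and 3/4. As
    slopes increase, each piece exceeds the previous one to the right of the break; smoothing takes
    place there, on a length e/8, where b, respectively c, is still constant. *)
Lemma reparam_catA (c b a u v : Cinf X) :
  cst_near_ends (sval c) -> cst_near_ends (sval b) ->
  sval u = catf (catf (sval c) (sval b)) (sval a) ->
  sval v = catf (sval c) (catf (sval b) (sval a)) -> reparam u v.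
Proof.
move=> /flat_ends_exists[e1 e1_gt0 fc] /flat_ends_exists[e2 e2_gt0 fb] uE vE.
pose e := Num.min (Num.min e1 e2) 2^-1.
have e_gt0 : 0 < e by rewrite !lt_min e1_gt0 e2_gt0; lra.
have e_le : e <= 2^-1 by rewrite ge_min lexx orbT.
have {}fc : flat_ends e (sval c) by apply: fc; rewrite !ge_min lexx.
have {}fb : flat_ends e (sval b) by apply: fb; rewrite !ge_min lexx orbT.
(* F smooths the first break and G the second. The constants c1 and c2 are the values of the two
   adjacent pieces at the midpoint of the smoothing interval. *)
have [F [gF F1 F2]] : exists F : R -> R, [/\ smooth_incr setT F,
    forall x, x <= 2^-1 -> F x = 2^-1 * x + 0 &
    forall x, 2^-1 + e / 8 <= x -> F x = 1 * x + - 4^-1].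
  apply: (@smooth_incr_interp R setT _ (2^-1 + e / 16) (2^-1 + e / 16) _
      (4^-1 + e / 32) (4^-1 + e / 16));
    [exact: openT|lra|lra|lra|lra| | |by move=> *; lra..].
    by apply: smooth_incr_sub (@smooth_incr_affine R 2^-1 0 _); [|lra].
  by apply: smooth_incr_sub (@smooth_incr_affine R 1 (- 4^-1) _); [|lra].
have [G [gG G1 G2]] : exists G : R -> R, [/\ smooth_incr setT G,
    forall x, x <= 3 / 4 -> G x = F x &
    forall x, 3 / 4 + e / 8 <= x -> G x = 2 * x + - 1].
  apply: (@smooth_incr_interp R setT _ (3 / 4 + e / 16) (3 / 4 + e / 16) _
      (2^-1 + e / 16) (2^-1 + e / 8));
    [exact: openT|lra|lra|lra|lra| | | |by move=> *; lra].
  - by apply: smooth_incr_sub gF.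
  - by apply: smooth_incr_sub (@smooth_incr_affine R 2 (- 1) _); [|lra].
  - by move=> x _ h; rewrite F2; lra.
have mG := smooth_incr_le gG.
apply: (smooth_incr_reparam gG).
- by rewrite G1 ?F1; lra.
- by rewrite G2; lra.
move=> x x01; rewrite uE vE; have [h1|h1] := ltP x 2^-1.
  rewrite catf_lt // G1 ?F1; [|lra|lra].
  by rewrite catf_lt ?catf_lt; [congr (sval a (clamp _))|..]; lra.
(* Just after 1/2, u at x and v at G x are both in the initial plateau of b. *)
rewrite catf_ge //; have [h2|h2] := ltP x (2^-1 + e / 8).
  have l1 : 4^-1 <= G x by move: h1; rewrite -(mG 2^-1) (G1 2^-1) ?F1; lra.
  have l2 : G x <= 4^-1 + e / 8.
    by move: (ltW h2); rewrite -(mG x) (G1 (2^-1 + e / 8)) ?F2; lra.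
  rewrite catf_lt; last lra.
  rewrite (fb _).1; last lra.
  rewrite catf_lt; last lra.
  by rewrite catf_ge ?(fb _).1 //; lra.
have [h3|h3] := ltP x (3 / 4).
  rewrite catf_lt ?G1 ?F2; [|lra..].
  by rewrite catf_lt ?catf_ge; [congr (sval b (clamp _))|..]; lra.
rewrite catf_ge; last lra.
have [h4|h4] := ltP x (3 / 4 + e / 8).
  have l1 : 2^-1 <= G x by move: h3; rewrite -(mG (3 / 4)) (G1 (3 / 4)) ?F2; lra.
  have l2 : G x <= 2^-1 + e / 4.
    by move: (ltW h4); rewrite -(mG x) (G2 (3 / 4 + e / 8)) //; lra.
  rewrite (fc _).1; last lra.
  by rewrite catf_ge ?(fc _).1 //; lra.
by rewrite G2 // catf_ge; [congr (sval c (clamp _))|..]; lra.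
Qed.

Lemma real_ext_bound (f : I -> I) (x : R) : 0 <= real_ext f x <= 1.
Proof. exact: Ival_bound. Qed.

(** Continuity of f at the end points, drawn from monotonicity and the preimages under f of e/2 and
    1 - e/2. *)
Lemma unit_diffeo_near_ends (f g : smap I I) (e : R) : unit_diffeo f g -> 0 < e <= 1 ->
  (exists2 l, 0 < l < e & real_ext (sval f) l < e) /\
  (exists2 r, 1 - e < r < 1 & 1 - e < real_ext (sval f) r).
Proof.
move=> fg /andP[e0 e1]; have [fK gK f0 f1] := fg; have fm := unit_diffeo_mono fg.
pose m := Ival (sval g (clamp (e / 2))); pose n := Ival (sval g (clamp (1 - e / 2))).
have /andP[m0 m1] : 0 <= m <= 1 by exact: Ival_bound.
have /andP[n0 n1] : 0 <= n <= 1 by exact: Ival_bound.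
have fmE : real_ext (sval f) m = e / 2 by rewrite /real_ext IvalK gK clampK; lra.
have fnE : real_ext (sval f) n = 1 - e / 2 by rewrite /real_ext IvalK gK clampK; lra.
have m_neq0 : m != 0.
  apply/eqP => m_eq0; move: fmE; rewrite m_eq0 /real_ext -/I0 f0 I0E; lra.
have n_neq1 : n != 1.
  apply/eqP => n_eq1; move: fnE; rewrite n_eq1 /real_ext -/I1 f1 I1E; lra.
have {m_neq0}m_gt0 : 0 < m by rewrite lt_neqAle eq_sym m_neq0.
have {n_neq1}n_lt1 : n < 1 by rewrite lt_neqAle n_neq1.
split.
  have lm : Num.min m (e / 2) <= m by rewrite ge_min lexx.
  have le2 : Num.min m (e / 2) <= e / 2 by rewrite ge_min lexx orbT.
  have l0 : 0 < Num.min m (e / 2) by rewrite lt_min m_gt0; lra.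
  exists (Num.min m (e / 2)); first lra.
  apply: (@le_lt_trans _ _ (real_ext (sval f) m)); last by rewrite fmE; lra.
  by rewrite fm // in_itv /=; lra.
have nr : n <= Num.max n (1 - e / 2) by rewrite le_max lexx.
have re : 1 - e / 2 <= Num.max n (1 - e / 2) by rewrite le_max lexx orbT.
have r1 : Num.max n (1 - e / 2) < 1 by rewrite gt_max n_lt1; lra.
exists (Num.max n (1 - e / 2)); first lra.
apply: (@lt_le_trans _ _ (real_ext (sval f) n)); first by rewrite fnE; lra.
by rewrite fm // in_itv /=; lra.
Qed.

(* Where a and a' are constant, the change of parameter may be modified at will:
   it is replaced by the identity near both ends, so that it can be glued with
   the identity on the half interval occupied by c. *)
Lemma reparam_cat (c a a' u v : Cinf X) : cst_near_ends (sval c) ->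
  cst_near_ends (sval a) -> cst_near_ends (sval a') -> sval c I0 = sval a I1 ->
  reparam a a' ->
  sval u = catf (sval c) (sval a) -> sval v = catf (sval c) (sval a') -> reparam u v.
Proof.
move=> /flat_ends_exists[e1 e1_gt0 fc] /flat_ends_exists[e2 e2_gt0 fa].
move=> /flat_ends_exists[e3 e3_gt0 fa'] ca [f [g [fK gK f0 f1 aE]]] uE vE.
have fg : unit_diffeo f g by [].
pose e := Num.min (Num.min (Num.min e1 e2) e3) 2^-1.
have e_gt0 : 0 < e by rewrite !lt_min e1_gt0 e2_gt0 e3_gt0; lra.
have e_le : e <= 2^-1 by rewrite ge_min lexx orbT.
have {}fc : flat_ends e (sval c) by apply: fc; rewrite !ge_min lexx.
have {}fa : flat_ends e (sval a) by apply: fa; rewrite !ge_min lexx orbT.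
have {}fa' : flat_ends e (sval a') by apply: fa'; rewrite !ge_min lexx orbT.
have a0 : sval a I0 = sval a' I0 by rewrite aE /= f0.
have a1 : sval a I1 = sval a' I1 by rewrite aE /= f1.
have [[l hl fl] [r hr fr]] : (exists2 l, 0 < l < e & real_ext (sval f) l < e) /\
  (exists2 r, 1 - e < r < 1 & 1 - e < real_ext (sval f) r).
  by apply: (unit_diffeo_near_ends fg); lra.
set h := real_ext (sval f) in fl fr.
have hm := unit_diffeo_mono fg; have hm' := leW_mono_in hm; rewrite -/h in hm hm'.
have h0 : h 0 = 0 by rewrite /h /real_ext -/I0 f0 I0E.
have h1 : h 1 = 1 by rewrite /h /real_ext -/I1 f1 I1E.
have hb x : 0 <= h x <= 1 by exact: real_ext_bound.
(* f rescaled to the half interval on which the concatenation runs through a. *)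
have gh : smooth_incr ([set x | 0 < x] `&` [set x | x < 2^-1]) (fun x => 2^-1 * h (2 * x + 0) + 0).
  apply: (@smooth_incr_comp R _ setT (fun x => h (2 * x + 0)) (fun x => 2^-1 * x + 0));
    [by apply: openI; [exact: open_gtr|exact: open_ltr]|exact: openT|by []| |].
    apply: (@smooth_incr_comp R _ ([set x | 0 < x] `&` [set x | x < 1]) (fun x => 2 * x + 0) h);
      [by apply: openI; [exact: open_gtr|exact: open_ltr]..| | |].
    - by move=> x [/= ? ?]; split=> /=; lra.
    - by apply: smooth_incr_sub (@smooth_incr_affine R 2 0 _); [|lra].
    - exact: unit_diffeo_smooth_incr fg.
  by apply: smooth_incr_affine; lra.
pose U := [set x : R | x < 2^-1].
have oU : open U by exact: open_ltr.
(* c2 is the value of h(2x)/2 at l/4. With y1 <= c2/2, the identity stays below c2/2 up to y1, while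
   h(2x)/2 stays above c2 from l/4 on. *)
pose c2 := 2^-1 * h (l / 2).
have c2_gt0 : 0 < c2.
  have : 0 < h (l / 2) by have := hm' 0 (l / 2); rewrite h0 => ->; rewrite ?in_itv /=; lra.
  by rewrite /c2; lra.
pose y1 := Num.min (c2 / 2) (l / 4).
have y1_gt0 : 0 < y1 by rewrite lt_min; lra.
have y1c : y1 <= c2 / 2 by rewrite ge_min lexx.
have y1l : y1 <= l / 4 by rewrite ge_min lexx orbT.
have [F [gF F1 F2]] : exists F : R -> R, [/\ smooth_incr U F,
    forall x, x <= y1 / 2 -> F x = x &
    forall x, l / 2 <= x -> F x = 2^-1 * h (2 * x + 0) + 0].
  apply: (@smooth_incr_interp R U _ y1 (l / 4) _ (c2 / 2) c2);
    [exact: oU|lra|lra|lra|lra|exact: smooth_incr_id| |by move=> *; lra|].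
    by apply: smooth_incr_sub gh => x [/= ? ?]; split=> //=; lra.
  move=> x _ hx; rewrite /c2 !addr0 ler_pM2l; last lra.
  by rewrite hm ?in_itv /=; lra.
have [G [gG G1 G2]] : exists G : R -> R, [/\ smooth_incr setT G,
    forall x, x <= r / 2 -> G x = F x & forall x, 2^-1 + e / 4 <= x -> G x = x].
  apply: (@smooth_incr_interp R setT _ ((r / 2 + 2^-1) / 2) (2^-1 + e / 8) _ 2^-1 (2^-1 + e / 8));
    [exact: openT|lra|lra|lra|lra| |exact: smooth_incr_id| |by move=> *; lra].
    by apply: smooth_incr_sub gF => x [_] /= ?; rewrite /U /=; lra.
  move=> x _ hx; rewrite F2; last lra.
  by have := hb (2 * x + 0); lra.
have mG := smooth_incr_le gG; have ltG := leW_mono mG.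
have Glr x : l / 2 <= x <= r / 2 -> G x = 2^-1 * h (2 * x + 0) + 0.
  by move=> hx; rewrite G1 ?F2 //; lra.
apply: (smooth_incr_reparam gG).
- by rewrite G1 ?F1; lra.
- by rewrite G2; lra.
(* Left of l/2 both sides equal a at 0, since h l < e. Between l/2 and r/2, G is the exact change of
   parameter. Up to 1/2 + e/4 both points lie in the plateau around 1/2, and beyond it G is the
   identity. *)
move=> x x01; rewrite uE vE; have [hx1|hx1] := ltP x (l / 2).
  have : G x < 2^-1 * e.
    move: hx1; rewrite -(ltG x) (Glr (l / 2)); last lra.
    by rewrite (_ : 2 * (l / 2) + 0 = l); lra.
  by move=> hG; rewrite !catf_lt ?(fa _).1 ?(fa' _).1 //; lra.
have [hx2|hx2] := ltP x (r / 2).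
  have h2x : h (2 * x) < 1 by have := hm' (2 * x) 1; rewrite h1 => ->; rewrite ?in_itv /=; lra.
  rewrite Glr; last lra.
  rewrite !addr0 !catf_lt; [|lra..].
  by rewrite (_ : 2 * (2^-1 * _) = h (2 * x)); [rewrite /h /real_ext IvalK aE|lra].
have [hx3|hx3] := ltP x (2^-1 + e / 4); last by rewrite G2 // !catf_ge //; lra.
have l1 : (1 - e) / 2 < G x.
  apply: (@lt_le_trans _ _ (G (r / 2))); last by rewrite mG.
  rewrite Glr; last lra.
  by rewrite (_ : 2 * (r / 2) + 0 = r); lra.
have l2 : G x < 2^-1 + e / 4 by move: hx3; rewrite -(ltG x) (G2 (2^-1 + e / 4)).
by rewrite !(@catf_plateau _ _ e) // -?a1 //; lra.
Qed.

End Reparam.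

(** * Retrace equivalence and transport *)

Section Retrace.
Context {R : realType}.
Variable X : diffSpace R.
Let I := @unitI R.
Local Notation cls := (qcls (@reparam R X)).

Lemma flip_smooth : smooth_map (fun t : I => clamp (1 - Ival t)).
Proof.
apply: (@smooth_clamp R setT (fun x => 1 - x)); first exact: openT.
  move=> k; have := @kdiff_affine R R k setT idfun (-1) 1 openT (kdiff_id _ _).
  by apply: kdiff_eq openT _ => x _; rewrite mulN1r addrC.
by move=> x h; split=> //; lra.
Qed.

Definition rev_path (a : Cinf X) : Cinf X := comp_map a (exist _ _ flip_smooth : smap I I).

Lemma revf0 (a : I -> X) : revf a I0 = a I1.
Proof. by rewrite /revf I0E subr0. Qed.

Lemma revf1 (a : I -> X) : revf a I1 = a I0.
Proof. by rewrite /revf I1E subrr. Qed.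

Lemma revf_ends (a : I -> X) : cst_near_ends a -> cst_near_ends (revf a).
Proof.
move=> [e e0 h]; exists e => // t; have tb := Ival_bound t.
rewrite revf0 revf1 /revf; split=> ht; [apply: (h _).2|apply: (h _).1];
  by rewrite clampK; lra.
Qed.

Definition flat_class (x : Cinf_sim X) := exists2 a, cst_near_ends (sval a) & x = cls a.

(** By [reparam_catA], c \/ (b \/ a) is (c \/ b) \/ a up to parameter, and likewise after the
    insertion of e: the step for b, e, a becomes the step for c \/ b, e, a. [reparam_cat] then
    passes to arbitrary representatives. *)
Lemma retrace_step_cat (c : Cinf X) (x y : Cinf_sim X) : cst_near_ends (sval c) ->
  retrace_step x y -> [/\ flat_class x, flat_class y &
  forall a a' u v : Cinf X, cst_near_ends (sval a) -> cst_near_ends (sval a') ->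
    sval c I0 = sval a I1 -> x = cls a -> y = cls a' ->
    sval u = catf (sval c) (sval a) -> sval v = catf (sval c) (sval a') ->
    retrace (cls u) (cls v)].
Proof.
move=> hc [b [e [a [p [q [[hb he ha] ba ea [Ep Eq] [-> ->]]]]]]].
have hr := revf_ends he.
have ra : sval (rev_path e) I0 = sval a I1 by rewrite -[LHS]/(revf (sval e) I0) revf0.
pose ra_ := Defs.cat (hr : cst_near_ends (sval (rev_path e))) ha ra.
have h1 : cst_near_ends (sval ra_) by exact: catf_ends.
have e0 : sval e I0 = sval ra_ I1 by rewrite /= catf1 -[RHS]/(revf (sval e) I1) revf1.
pose ea_ := Defs.cat he h1 e0.
have h2 : cst_near_ends (sval ea_) by exact: catf_ends.
have b2 : sval b I0 = sval ea_ I1 by rewrite /= catf1 ea.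
have hp : cst_near_ends (sval p) by rewrite Ep; exact: catf_ends.
have hq : cst_near_ends (sval q) by rewrite Eq; exact: catf_ends hb h2.
split; [by exists p|by exists q|].
move=> a1 a2 u v ha1 ha2 ca1 /(qclsP (@reparam_refl _ _)) pa1
  /(qclsP (@reparam_refl _ _)) qa2 uE vE.
have cb : sval c I0 = sval b I1 by rewrite ca1 -(reparam_end pa1) Ep catf1.
have cp : sval c I0 = sval p I1 by rewrite Ep catf1.
have cq : sval c I0 = sval q I1 by rewrite Eq catf1.
pose cb_ := Defs.cat hc hb cb.
have hcb : cst_near_ends (sval cb_) by exact: catf_ends.
have cba : sval cb_ I0 = sval a I1 by rewrite /= catf0.
have cbea : sval cb_ I0 = sval ea_ I1 by rewrite /= catf0 catf1 ea.
have RP : reparam (Defs.cat hcb ha cba) (Defs.cat hc hp cp).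
  by apply: (@reparam_catA _ _ c b a); rewrite //= Ep.
have RQ : reparam (Defs.cat hcb h2 cbea) (Defs.cat hc hq cq).
  by apply: (@reparam_catA _ _ c b ea_); rewrite //= Eq.
have RP2 : reparam (Defs.cat hc hp cp) u by apply: (@reparam_cat _ _ c p a1).
have RQ2 : reparam (Defs.cat hc hq cq) v by apply: (@reparam_cat _ _ c q a2).
rewrite -(qcls_reparam (reparam_trans RP RP2)) -(qcls_reparam (reparam_trans RQ RQ2)).
apply: rst_step; exists cb_, e, a, (Defs.cat hcb ha cba), (Defs.cat hcb h2 cbea).
by split.
Qed.

(** Transitivity concatenates c with the middle class, which requires a representative constant near
    its ends. Both ends of a step have one; reflexivity holds at arbitrary classes, whence the
    alternative x = y. *)
Lemma retrace_flat_cat (c : Cinf X) (x y : Cinf_sim X) : cst_near_ends (sval c) ->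
  retrace x y -> x = y \/ [/\ flat_class x, flat_class y &
  forall a a' u v : Cinf X, cst_near_ends (sval a) -> cst_near_ends (sval a') ->
    sval c I0 = sval a I1 -> x = cls a -> y = cls a' ->
    sval u = catf (sval c) (sval a) -> sval v = catf (sval c) (sval a') ->
    retrace (cls u) (cls v)].
Proof.
move=> hc; elim=> [{}x {}y xy|{}x|{}x {}y xy IH|{}x {}y z xy IHxy yz IHyz].
- by right; exact: retrace_step_cat.
- by left.
- case: IH => [->|[fx fy H]]; [by left|right; split=> // a a' u v ha ha' ca ya xa' uE vE].
  apply: rst_sym; apply: (H a' a) => //.
  by rewrite (retrace_end xy xa' ya).
- case: IHxy => [->|[fx fy H]]; first exact: IHyz.
  case: IHyz => [<-|[_ fz K]]; first by right.
  right; split=> // a a' u v ha ha' ca xa za' uE vE.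
  have [d hd yd] := fy.
  have cd : sval c I0 = sval d I1 by rewrite ca (retrace_end xy xa yd).
  apply: rst_trans (K d a' (Defs.cat hc hd cd) v hd ha' cd yd za' erefl vE).
  exact: (H a d u (Defs.cat hc hd cd)).
Qed.

Lemma Fcls_retrace (a b : Cinf X) : retrace (cls a) (cls b) -> Fcls a = Fcls b.
Proof.
move=> ab; apply: eq_exist; apply/funext => z; apply/propext; split.
  exact: rst_trans (rst_sym _ _ _ _ ab).
exact: rst_trans ab.
Qed.

Lemma Fcls_reparam (a b : Cinf X) : reparam a b -> Fcls a = Fcls b.
Proof. by move=> ab; rewrite /Fcls (qcls_reparam ab). Qed.

Lemma Fcls_cat (c a a' u v : Cinf X) : cst_near_ends (sval c) ->
  cst_near_ends (sval a) -> cst_near_ends (sval a') -> sval c I0 = sval a I1 ->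
  Fcls a = Fcls a' ->
  sval u = catf (sval c) (sval a) -> sval v = catf (sval c) (sval a') -> Fcls u = Fcls v.
Proof.
move=> hc ha ha' ca /(qclsP (@retrace_refl _ _)) aa' uE vE.
have [/(qclsP (@reparam_refl _ _)) r|[_ _ H]] := retrace_flat_cat hc aa'.
  exact: Fcls_reparam (reparam_cat hc ha ha' ca r uE vE).
exact: Fcls_retrace (H a a' u v ha ha' ca erefl erefl uE vE).
Qed.

Variables (x0 : X) (phi : flattening R).

Lemma transport_eq (c c' : smooth_path X) (r : R) (b b' : Cinf X)
    (hb : based x0 b) (hb' : based x0 b')
    (hr : c r = Some (sval b I1)) (hr' : c' r = Some (sval b' I1)) :
  c = c' -> Fcls b = Fcls b' -> transport phi hb hr = transport phi hb' hr'.
Proof.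
move=> cc; case: c' / cc hr' => hr' bb'; apply: path_eq => s /=.
rewrite /transport_fun; case: pselect => // hs; congr Some; apply: eq_exist.
apply: (@Fcls_cat (flat_seg phi hr hs) b b' _ _ (flat_seg_ends phi hr hs) hb.1 hb'.1 _ bb').
- exact: flat_seg0.
- by [].
(* The two segments carry different proofs that r is in the domain of c, but have the same
   values. *)
- congr catf; apply/funext => t; apply: oval_eq.
  exact: esym (ovalE _).
Qed.

(** As phi fixes 1, the path prolonged to time s ends at c(s). At s = r the added segment is
    constant, so [reparam_cst_cat] gives back the class of b. *)
Lemma transport_lift (c : smooth_path X) (r : R) (b : Cinf X) (hb : based x0 b)
    (hr : c r = Some (sval b I1)) :
  lift_at tau c r (class_of_based hb) (transport phi hb hr).
Proof.
have [_ _ phi1] := svalP phi; split.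
  apply/funext => s; rewrite /= /transport_fun; case: pselect => [hs|] /=.
    rewrite tau_class /= catf1 /= phi1 /seg_fun ovalE I1E.
    by rewrite mul1r subrr mul0r addr0.
  by rewrite /pdom /=; case: (c s).
rewrite /= /transport_fun; case: pselect => [hs|[]]; last by rewrite /pdom /= hr.
congr Some; apply: eq_exist; apply: esym; apply: Fcls_reparam.
apply: (@reparam_cst_cat _ _ (flat_seg phi hr hs) b) => //; first exact: hb.1.
move=> t; apply: oval_eq; rewrite -hr; congr (path_fun c _); ring.
Qed.

End Retrace.

Theorem proposition3p12 (R : realType) (X : diffSpace R) (pt : X)
    (Xconn : path_connected X) (phi : flattening R)
    (alpha : smooth_path X) (t0 : R) (ht0 : pdom alpha t0)
    (beta0 : Cinf X) (hbeta0 : based pt beta0)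
    (hfib : alpha t0 = Some (tau (class_of_based hbeta0))) :
  is_hor tau (Theta phi) alpha t0 (class_of_based hbeta0) (alpha_bar phi hfib).
Proof.
have lift := transport_lift phi hbeta0 (etrans hfib (congr1 Some (tau_class hbeta0))).
have Theta_lift (l : smooth_path (pointedF pt)) (h : pdom l t0) :
    lift_at tau alpha t0 (class_of_based hbeta0) l ->
    Theta phi (exist _ (l, t0) h) = alpha_bar phi hfib.
  move=> [la lt0]; apply: transport_eq.
    by apply: path_eq => t; rewrite -la.
  (* [rep] may choose another path than [beta0], but in the same class, which is all that
     [transport_eq] asks for. *)
  have -> : theta_start (exist _ (l, t0) h) = class_of_based hbeta0 by exact: oval_eq.
  exact: (congr1 sval (repK (class_of_based hbeta0))).
have dom : pdom (alpha_bar phi hfib) t0 by exact: (congr1 isSome lift.2).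
(* [alpha_bar] is itself a lift: it witnesses existence and, being fixed by [Theta], is
   horizontal. *)
split; [exists t0, dom|exists (alpha_bar phi hfib)|] => //.
exact: Theta_lift.
Qed.
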